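(* For any $d \geq 2$, $\mathsf{BT}_d$ implies $\mathsf{WKL}_0$ over $\mathsf{RCA}_0$.
   Context: Work in second order arithmetic. A graph is a pair $G=(V,E)$ with $V\subseteq\mathbb{N}$ nonempty and $E\subseteq V^2$ symmetric and irreflexive. $\delta(x)$ is the number of neighbors of $x$; for a graph of finite degree, $\Delta(G)=\max_x\delta(x)$. A $(d+1)$-clique is a set of $d+1$ pairwise adjacent vertices. A cycle is a sequence of pairwise distinct vertices $(v(i):i<n)$ with consecutive ones adjacent and $v(0)Ev(n-1)$; it is odd if $n$ is odd. ''$\chi(G)\le d$'' means $G$ has a proper $d$-coloring. $\mathsf{BT}_2$: every graph $G$ with $\Delta(G)=2$ and no odd cycles has $\chi(G)\le 2$. For $d\ge3$, $\mathsf{BT}_d$: every graph $G$ with $\Delta(G)=d$ inducing no $(d+1)$-clique has $\chi(G)\le d$. *)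

(* Defs.v *)
From Stdlib Require Import Arith.

(** * Structures for the language of second order arithmetic

    Arbitrary two-sorted (Henkin) structures: the numbers may be nonstandard
    and the set quantifiers range over [sets] only.  Equality of sets is not
    primitive in the language. *)

Record L2_structure : Type := {
  num : Type;
  sets : Type;
  zero : num;
  one : num;
  add : num -> num -> num;
  mul : num -> num -> num;
  lt : num -> num -> Prop;
  mem : num -> sets -> Prop
}.

Arguments zero {_}.
Arguments one {_}.
Arguments add {_} _ _.
Arguments mul {_} _ _.
Arguments lt {_} _ _.
Arguments mem {_} _ _.

Declare Scope l2_scope.
Delimit Scope l2_scope with l2.
Notation "x + y" := (add x y) : l2_scope.
Notation "x * y" := (mul x y) : l2_scope.
Notation "x < y" := (lt x y) : l2_scope.
Notation "x <= y" := (lt x y \/ x = y) : l2_scope.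
Notation "0" := zero : l2_scope.
Notation "1" := one : l2_scope.
Notation "x 'in_' X" := (mem x X) (at level 70) : l2_scope.
Local Open Scope l2_scope.

(** * Formulas for the axiom schemes

    [Var i] is a de Bruijn index.  In [In t X], [X] is the index of a set
    variable; set variables are always free (set parameters). *)

Inductive term : Type :=
| Var (i : nat)
| Zero
| One
| Add (t u : term)
| Mul (t u : term).

(** In [AllLt t p] and [ExLt t p] the bound [t] lies outside the scope of the
    quantifier; index 0 of [p] is the bound variable. *)
Inductive bounded_formula : Type :=
| Eq (t u : term)
| Lt (t u : term)
| In (t : term) (X : nat)
| Not (p : bounded_formula)
| And (p q : bounded_formula)
| Or (p q : bounded_formula)
| Imp (p q : bounded_formula)
| AllLt (t : term) (p : bounded_formula)
| ExLt (t : term) (p : bounded_formula).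

Definition scons {A : Type} (a : A) (e : nat -> A) : nat -> A :=
  fun i => match i with O => a | S j => e j end.

Fixpoint eval {M : L2_structure} (e : nat -> num M) (t : term) : num M :=
  match t with
  | Var i => e i
  | Zero => 0
  | One => 1
  | Add t u => eval e t + eval e u
  | Mul t u => eval e t * eval e u
  end.

Fixpoint sat {M : L2_structure} (s : nat -> sets M) (e : nat -> num M)
    (p : bounded_formula) : Prop :=
  match p with
  | Eq t u => eval e t = eval e u
  | Lt t u => eval e t < eval e u
  | In t X => eval e t in_ s X
  | Not p => ~ sat s e p
  | And p q => sat s e p /\ sat s e q
  | Or p q => sat s e p \/ sat s e q
  | Imp p q => sat s e p -> sat s e q
  | AllLt t p => forall x, x < eval e t -> sat s (scons x e) p
  | ExLt t p => exists x, x < eval e t /\ sat s (scons x e) p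
  end.

(** The formulas [exists x, p(x, n)] and [forall x, p(x, n)], with [x] at
    index 0, [n] at index 1 and the number parameters [e] from index 2 on. *)
Definition sigma1 {M : L2_structure} (s : nat -> sets M) (e : nat -> num M)
    (p : bounded_formula) (n : num M) : Prop :=
  exists x, sat s (scons x (scons n e)) p.

Definition pi1 {M : L2_structure} (s : nat -> sets M) (e : nat -> num M)
    (p : bounded_formula) (n : num M) : Prop :=
  forall x, sat s (scons x (scons n e)) p.

(** * The system RCA_0 *)

Record basic_axioms (M : L2_structure) : Prop := {
  succ_neq0 : forall n : num M, n + 1 <> 0;
  succ_inj : forall m n : num M, m + 1 = n + 1 -> m = n;
  add_0 : forall m : num M, m + 0 = m;
  add_succ : forall m n : num M, m + (n + 1) = (m + n) + 1;
  mul_0 : forall m : num M, m * 0 = 0;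
  mul_succ : forall m n : num M, m * (n + 1) = m * n + m;
  not_lt_0 : forall m : num M, ~ m < 0;
  lt_succ : forall m n : num M, m < n + 1 <-> m <= n
}.

Definition sigma1_induction (M : L2_structure) : Prop :=
  forall (p : bounded_formula) (s : nat -> sets M) (e : nat -> num M),
    sigma1 s e p 0 ->
    (forall n, sigma1 s e p n -> sigma1 s e p (n + 1)) ->
    forall n, sigma1 s e p n.

Definition delta1_comprehension (M : L2_structure) : Prop :=
  forall (p q : bounded_formula) (s : nat -> sets M) (e : nat -> num M),
    (forall n, sigma1 s e p n <-> pi1 s e q n) ->
    exists X : sets M, forall n, n in_ X <-> sigma1 s e p n.

(** Set assignments [nat -> sets M] exist only if there is a set, as first
    order logic presupposes for every sort; hence [sets_nonempty]. *)
Record RCA0 (M : L2_structure) : Prop := {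
  sets_nonempty : exists X : sets M, True;
  RCA0_basic : basic_axioms M;
  RCA0_induction : sigma1_induction M;
  RCA0_comprehension : delta1_comprehension M
}.

(** * Functions and cardinality inside a structure *)

Definition pair {M : L2_structure} (i j : num M) : num M :=
  (i + j) * (i + j) + i.

Definition below {M : L2_structure} (n : num M) : num M -> Prop :=
  fun i => i < n.

(** The set [f] is (the graph of) a function from [X] to [Y]. *)
Definition is_function {M : L2_structure} (f : sets M) (X Y : num M -> Prop) :
    Prop :=
  (forall p, p in_ f -> exists i j, X i /\ Y j /\ p = pair i j) /\
  (forall i, X i -> exists! j, pair i j in_ f).

Definition is_injective {M : L2_structure} (f : sets M) : Prop :=
  forall i i' j, pair i j in_ f -> pair i' j in_ f -> i = i'.

Definition has_card {M : L2_structure} (X : num M -> Prop) (n : num M) : Prop :=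
  exists f : sets M,
    is_function f (below n) X /\ is_injective f /\
    (forall x, X x -> exists i, pair i x in_ f).

Fixpoint numeral {M : L2_structure} (n : nat) : num M :=
  match n with
  | O => 0
  | S m => numeral m + 1
  end.

(** * Graphs *)

Record graph (M : L2_structure) : Type := {
  V : sets M;
  E : sets M;
  V_nonempty : exists x, x in_ V;
  E_sub : forall p, p in_ E -> exists x y, x in_ V /\ y in_ V /\ p = pair x y;
  E_sym : forall x y, pair x y in_ E -> pair y x in_ E;
  E_irrefl : forall x, ~ pair x x in_ E
}.

Arguments V {_} _.
Arguments E {_} _.

Definition adj {M : L2_structure} (G : graph M) (x y : num M) : Prop :=
  pair x y in_ E G.

Definition degree {M : L2_structure} (G : graph M) (x k : num M) : Prop :=
  has_card (adj G x) k.

Definition max_degree {M : L2_structure} (G : graph M) (d : num M) : Prop :=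
  (forall x, x in_ V G -> exists k, degree G x k /\ k <= d) /\
  (exists x, x in_ V G /\ degree G x d).

Definition is_clique {M : L2_structure} (G : graph M) (n : num M) (K : sets M) :
    Prop :=
  has_card (fun x => x in_ K) n /\
  (forall x, x in_ K -> x in_ V G) /\
  (forall x y, x in_ K -> y in_ K -> x <> y -> adj G x y).

Definition is_cycle {M : L2_structure} (G : graph M) (n : num M) (v : sets M) :
    Prop :=
  is_function v (below n) (fun x => x in_ V G) /\
  is_injective v /\
  (forall i x y, i + 1 < n -> pair i x in_ v -> pair (i + 1) y in_ v ->
     adj G x y) /\
  (exists m x y, n = m + 1 /\ pair 0 x in_ v /\ pair m y in_ v /\ adj G x y).

Definition odd {M : L2_structure} (n : num M) : Prop := exists m, n = m + m + 1.

Definition colorable {M : L2_structure} (G : graph M) (d : num M) : Prop :=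
  exists c : sets M,
    is_function c (fun x => x in_ V G) (below d) /\
    (forall x y i, adj G x y -> pair x i in_ c -> ~ pair y i in_ c).

(** The natural number [d] is standard: BT_d is one sentence for each [d].
    Meaningful for [d >= 2] only. *)
Definition BT (d : nat) (M : L2_structure) : Prop :=
  forall G : graph M,
    max_degree G (numeral d) ->
    (if Nat.eqb d 2
     then ~ (exists n v, odd n /\ is_cycle G n v)
     else ~ (exists K, is_clique G (numeral (S d)) K)) ->
    colorable G (numeral d).

(** * Weak Koenig's lemma *)

(** A number [(k, (m, n))] represents the finite set of all [i < k] such that
    [m(i+1)+1] divides [n]; the code of a finite set is its least
    representative. *)
Definition in_fin {M : L2_structure} (i c : num M) : Prop :=
  exists k m n, c = pair k (pair m n) /\ i < k /\
    exists q, n = q * (m * (i + 1) + 1).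

Definition is_fin_code {M : L2_structure} (c : num M) : Prop :=
  (exists k m n, c = pair k (pair m n)) /\
  (forall k m n, pair k (pair m n) < c ->
     ~ (forall i, in_fin i (pair k (pair m n)) <-> in_fin i c)).

(** [is_seq s l]: [s] is the code of a finite sequence of length [l], the
    sequence being the finite set of the pairs (index, entry). *)
Definition is_seq {M : L2_structure} (s l : num M) : Prop :=
  is_fin_code s /\
  (forall p, in_fin p s -> exists i j, p = pair i j) /\
  (forall i j j', in_fin (pair i j) s -> in_fin (pair i j') s -> j = j') /\
  (forall i, i < l <-> exists j, in_fin (pair i j) s).

Definition is_binary_seq {M : L2_structure} (s : num M) : Prop :=
  exists l, is_seq s l /\ forall i j, in_fin (pair i j) s -> j = 0 \/ j = 1.

Definition initial_segment {M : L2_structure} (s t : num M) : Prop :=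
  exists l l', is_seq s l /\ is_seq t l' /\ l <= l' /\
    forall i j, in_fin (pair i j) s -> in_fin (pair i j) t.

Definition is_binary_tree {M : L2_structure} (T : sets M) : Prop :=
  (forall s, s in_ T -> is_binary_seq s) /\
  (forall s t, initial_segment s t -> t in_ T -> s in_ T).

Definition is_infinite {M : L2_structure} (X : sets M) : Prop :=
  forall n, exists m, n < m /\ m in_ X.

(** [g] is a function on the numbers all of whose restrictions
    [(g(0), ..., g(n-1))] belong to [T]. *)
Definition is_path {M : L2_structure} (g T : sets M) : Prop :=
  is_function g (fun _ => True) (fun _ => True) /\
  (forall n, exists s, s in_ T /\ is_seq s n /\
     forall i j, in_fin (pair i j) s -> pair i j in_ g).

Definition WKL (M : L2_structure) : Prop :=
  forall T : sets M, is_binary_tree T -> is_infinite T -> exists g, is_path g T.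

Record WKL0 (M : L2_structure) : Prop := {
  WKL0_RCA0 : RCA0 M;
  WKL0_WKL : WKL M
}.

(** * Implication over a base system

    Logical consequence with respect to all structures for the language (by
    completeness, the same as provability). *)
Definition implies_over (T P Q : L2_structure -> Prop) : Prop :=
  forall M : L2_structure, T M -> P M -> Q M.

(* Main.v *)
(** For each number [x] let [a_x] and [b_x] be vertices.  When [y] is found to
    witness a first Sigma_1 condition on [x], a new [(d-1)]-clique is joined to
    [a_x] and [b_x], so that they have the same color in every [d]-coloring;
    when [y] witnesses a second, incompatible condition, the clique is joined
    to [a_x] and to a new vertex adjacent to [b_x], so that they have different
    colors.  The degrees are at most [d], those of [a_x] and [b_x] are less
    than [d], and every vertex of degree [d] has one of these as a neighbor;
    hence there is no [(d+1)]-clique, and no cycle if [d = 2].  A [d]-coloring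
    of this graph thus separates the two conditions.

    Given an infinite binary tree, let a set separate the strings for which at
    some level [n] only the extension by 1 has a descendant of length [n] from
    those for which only the extension by 0 has one; it determines a path. *)

From Stdlib Require Import Classical List Arith Lia Ring.
Require Import Defs.
Import ListNotations.
Local Open Scope l2_scope.

(** * Definability in a model *)

Existing Class RCA0.

Section Definability.
Context {M : L2_structure}.

Fixpoint prepend {A : Type} (l : list A) (r : nat -> A) : nat -> A :=
  match l with nil => r | a :: l => scons a (prepend l r) end.

Lemma prepend_app {A : Type} (l l' : list A) (r : nat -> A) :
  prepend (l ++ l') r = prepend l (prepend l' r).
Proof. induction l as [|a l IH]; simpl; congruence. Qed.

Lemma prepend_length {A : Type} (l : list A) (r : nat -> A) (i : nat) :
  prepend l r (length l + i) = r i.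
Proof. induction l; simpl; auto. Qed.

Definition with_params (k : nat) (e r : nat -> num M) : nat -> num M :=
  fun i => if (i <? k)%nat then e i else r (i - k)%nat.

(** [Tm k f] and [Def k P]: the function [f] and the predicate [P] on
    environments are given by a term and a bounded formula in the first [k]
    variables, with number and set parameters from [M].  The lists [l0] and
    [s0] are parameters that are already in use; they make it possible to
    combine formulas without renaming variables. *)
Definition Tm (k : nat) (f : (nat -> num M) -> num M) : Prop :=
  forall l0, exists l t, forall r e,
    f e = eval (with_params k e (prepend (l0 ++ l) r)) t.

Definition Def (k : nat) (P : (nat -> num M) -> Prop) : Prop :=
  forall l0 s0, exists l s1 p, forall r s e,
    P e <-> sat (prepend (s0 ++ s1) s)
              (with_params k e (prepend (l0 ++ l) r)) p.

Lemma eval_ext (e e' : nat -> num M) (t : term) :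
  (forall i, e i = e' i) -> eval e t = eval e' t.
Proof. intros H; induction t; simpl; congruence. Qed.

Lemma sat_ext (s : nat -> sets M) (p : bounded_formula) :
  forall e e', (forall i, e i = e' i) -> (sat s e p <-> sat s e' p).
Proof.
  induction p; intros e e' H; simpl;
    try rewrite (eval_ext e e' t H); try rewrite (eval_ext e e' u H);
    try (specialize (IHp1 e e' H)); try (specialize (IHp2 e e' H));
    try tauto.
  - now rewrite (IHp e e' H).
  - assert (K : forall x, sat s (scons x e) p <-> sat s (scons x e') p)
      by (intros x; apply IHp; intros [|i]; simpl; auto).
    firstorder.
  - assert (K : forall x, sat s (scons x e) p <-> sat s (scons x e') p)
      by (intros x; apply IHp; intros [|i]; simpl; auto).
    firstorder.
Qed.

Lemma Tm_var (k i : nat) : (i < k)%nat -> Tm k (fun e => e i).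
Proof.
  intros H l0; exists nil, (Var i); intros r e; simpl; unfold with_params.
  now apply Nat.ltb_lt in H as ->.
Qed.

Lemma Tm_const (k : nat) (a : num M) : Tm k (fun _ => a).
Proof.
  intros l0; exists [a], (Var (k + length l0)); intros r e; simpl.
  unfold with_params.
  destruct (Nat.ltb_spec (k + length l0) k); [lia|].
  rewrite prepend_app, Nat.add_comm, Nat.add_sub.
  now rewrite <- (Nat.add_0_r (length l0)), prepend_length.
Qed.

Lemma Tm_binop (op : num M -> num M -> num M) (c : term -> term -> term)
    (Hc : forall e t u, eval e (c t u) = op (eval e t) (eval e u))
    (k : nat) (f g : (nat -> num M) -> num M) :
  Tm k f -> Tm k g -> Tm k (fun e => op (f e) (g e)).
Proof.
  intros F G l0; destruct (F l0) as (l & t & Ht).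
  destruct (G (l0 ++ l)) as (l' & u & Hu).
  exists (l ++ l'), (c t u); intros r e; rewrite Hc, app_assoc.
  f_equal; auto. rewrite prepend_app; auto.
Qed.

Lemma Tm_add (k : nat) (f g : (nat -> num M) -> num M) :
  Tm k f -> Tm k g -> Tm k (fun e => f e + g e).
Proof. now apply (Tm_binop add Add). Qed.

Lemma Tm_mul (k : nat) (f g : (nat -> num M) -> num M) :
  Tm k f -> Tm k g -> Tm k (fun e => f e * g e).
Proof. now apply (Tm_binop mul Mul). Qed.

Fixpoint lift (t : term) : term :=
  match t with
  | Var i => Var (S i)
  | Zero => Zero
  | One => One
  | Add t u => Add (lift t) (lift u)
  | Mul t u => Mul (lift t) (lift u)
  end.

Lemma Tm_weaken (k : nat) (f : (nat -> num M) -> num M) :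
  Tm k f -> Tm (S k) (fun e => f (fun i => e (S i))).
Proof.
  intros F l0; destruct (F l0) as (l & t & Ht).
  exists l, (lift t); intros r e; rewrite (Ht r); clear.
  induction t; simpl; [reflexivity|congruence..].
Qed.

Lemma Tm_pair (k : nat) (f g : (nat -> num M) -> num M) :
  Tm k f -> Tm k g -> Tm k (fun e => pair (f e) (g e)).
Proof.
  intros F G; unfold pair.
  apply (Tm_add k (fun e => (f e + g e) * (f e + g e)) f); auto.
  apply (Tm_mul k (fun e => f e + g e) (fun e => f e + g e));
    apply (Tm_add k f g); auto.
Qed.

Lemma Def_ext (k : nat) (P Q : (nat -> num M) -> Prop) :
  (forall e, P e <-> Q e) -> Def k Q -> Def k P.
Proof.
  intros H D l0 s0; destruct (D l0 s0) as (l & s1 & p & Hp).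
  exists l, s1, p; intros; rewrite H; apply Hp.
Qed.

Lemma Def_atom (R : num M -> num M -> Prop)
    (c : term -> term -> bounded_formula)
    (Hc : forall s e t u, sat s e (c t u) <-> R (eval e t) (eval e u))
    (k : nat) (f g : (nat -> num M) -> num M) :
  Tm k f -> Tm k g -> Def k (fun e => R (f e) (g e)).
Proof.
  intros F G l0 s0; destruct (F l0) as (l & t & Ht).
  destruct (G (l0 ++ l)) as (l' & u & Hu).
  exists (l ++ l'), nil, (c t u); intros r s e.
  rewrite Hc, app_assoc, <- (Hu r e), prepend_app, <- (Ht _ e).
  reflexivity.
Qed.

Lemma Def_eq (k : nat) (f g : (nat -> num M) -> num M) :
  Tm k f -> Tm k g -> Def k (fun e => f e = g e).
Proof. apply (Def_atom eq Eq); reflexivity. Qed.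

Lemma Def_lt (k : nat) (f g : (nat -> num M) -> num M) :
  Tm k f -> Tm k g -> Def k (fun e => f e < g e).
Proof. apply (Def_atom lt Lt); reflexivity. Qed.

Lemma Def_mem (k : nat) (f : (nat -> num M) -> num M) (A : sets M) :
  Tm k f -> Def k (fun e => f e in_ A).
Proof.
  intros F l0 s0; destruct (F l0) as (l & t & Ht).
  exists l, [A], (In t (length s0)); intros r s e; simpl.
  rewrite <- (Ht r e), prepend_app, <- (Nat.add_0_r (length s0)),
    prepend_length.
  reflexivity.
Qed.

Lemma Def_not (k : nat) (P : (nat -> num M) -> Prop) :
  Def k P -> Def k (fun e => ~ P e).
Proof.
  intros D l0 s0; destruct (D l0 s0) as (l & s1 & p & Hp).
  exists l, s1, (Not p); intros r s e; simpl; rewrite (Hp r s e); reflexivity.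
Qed.

Lemma Def_connective (op : Prop -> Prop -> Prop)
    (c : bounded_formula -> bounded_formula -> bounded_formula)
    (Hop : forall A A' B B', (A <-> A') -> (B <-> B') -> (op A B <-> op A' B'))
    (Hc : forall (s : nat -> sets M) e p q,
        sat s e (c p q) <-> op (sat s e p) (sat s e q))
    (k : nat) (P Q : (nat -> num M) -> Prop) :
  Def k P -> Def k Q -> Def k (fun e => op (P e) (Q e)).
Proof.
  intros DP DQ l0 s0; destruct (DP l0 s0) as (l & s1 & p & Hp).
  destruct (DQ (l0 ++ l) (s0 ++ s1)) as (l' & s2 & q & Hq).
  exists (l ++ l'), (s1 ++ s2), (c p q); intros r s e.
  rewrite Hc, !app_assoc; apply Hop; auto.
  rewrite !prepend_app, <- !(prepend_app l0), <- !(prepend_app s0); auto.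
Qed.

Lemma Def_and (k : nat) (P Q : (nat -> num M) -> Prop) :
  Def k P -> Def k Q -> Def k (fun e => P e /\ Q e).
Proof. apply (Def_connective and And); simpl; tauto. Qed.

Lemma Def_or (k : nat) (P Q : (nat -> num M) -> Prop) :
  Def k P -> Def k Q -> Def k (fun e => P e \/ Q e).
Proof. apply (Def_connective or Or); simpl; tauto. Qed.

Lemma Def_imp (k : nat) (P Q : (nat -> num M) -> Prop) :
  Def k P -> Def k Q -> Def k (fun e => P e -> Q e).
Proof.
  apply (Def_connective (fun A B => A -> B) Imp); simpl; tauto.
Qed.

Lemma Def_iff (k : nat) (P Q : (nat -> num M) -> Prop) :
  Def k P -> Def k Q -> Def k (fun e => P e <-> Q e).
Proof.
  intros; unfold iff.
  apply (Def_and k (fun e => P e -> Q e) (fun e => Q e -> P e));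
    apply Def_imp; auto.
Qed.

Lemma Def_prop (k : nat) (Q : Prop) : Def k (fun _ => Q).
Proof.
  intros l0 s0; destruct (classic Q).
  - exists nil, nil, (Eq Zero Zero); simpl; tauto.
  - exists nil, nil, (Not (Eq Zero Zero)); simpl; tauto.
Qed.

Lemma scons_with_params (k : nat) (e r : nat -> num M) (x : num M) (i : nat) :
  scons x (with_params k e r) i = with_params (S k) (scons x e) r i.
Proof. destruct i; reflexivity. Qed.

Lemma Def_alllt (k : nat) (f : (nat -> num M) -> num M)
    (Q : (nat -> num M) -> num M -> Prop) :
  Tm k f -> Def (S k) (fun e => Q (fun i => e (S i)) (e O)) ->
  Def k (fun e => forall x, x < f e -> Q e x).
Proof.
  intros F D l0 s0; destruct (F l0) as (l & t & Ht).
  destruct (D (l0 ++ l) s0) as (l' & s1 & p & Hp).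
  exists (l ++ l'), s1, (AllLt t p); intros r s e; simpl.
  rewrite app_assoc, prepend_app, <- (Ht _ e), <- prepend_app.
  assert (K : forall x, Q e x <->
      sat (prepend (s0 ++ s1) s)
        (scons x (with_params k e (prepend ((l0 ++ l) ++ l') r))) p).
  { intros x; rewrite (sat_ext _ p _ _ (scons_with_params _ _ _ x)).
    apply (Hp r s (scons x e)). }
  firstorder.
Qed.

Lemma Def_exlt (k : nat) (f : (nat -> num M) -> num M)
    (Q : (nat -> num M) -> num M -> Prop) :
  Tm k f -> Def (S k) (fun e => Q (fun i => e (S i)) (e O)) ->
  Def k (fun e => exists x, x < f e /\ Q e x).
Proof.
  intros F D; apply Def_ext with (fun e => ~ forall x, x < f e -> ~ Q e x).
  - intros e; split.
    + firstorder.
    + intros H; apply not_all_ex_not in H as (x & H); exists x; tauto.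
  - apply Def_not, (Def_alllt k f (fun e x => ~ Q e x)); auto.
    now apply (Def_not (S k) (fun e => Q (fun i => e (S i)) (e O))).
Qed.

Lemma Def_exists_list {A : Type} (k : nat) (L : list A)
    (P : A -> (nat -> num M) -> Prop) :
  (forall a, Def k (P a)) -> Def k (fun e => exists a, List.In a L /\ P a e).
Proof.
  intros D; induction L as [|a L IH].
  - apply Def_ext with (fun _ => False); [firstorder|apply Def_prop].
  - apply Def_ext with (fun e => P a e \/ exists b, List.In b L /\ P b e).
    + intros e; simpl; split.
      * intros (b & [<-|H] & Hb); eauto.
      * intros [H|(b & H & Hb)]; eauto.
    + now apply (Def_or k (P a)).
Qed.

Definition Def1 (P : num M -> Prop) : Prop :=
  forall k f, Tm k f -> Def k (fun e => P (f e)).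

Definition Def2 (P : num M -> num M -> Prop) : Prop :=
  forall k f g, Tm k f -> Tm k g -> Def k (fun e => P (f e) (g e)).

End Definability.

Ltac def_user := fail.

Ltac weaken_exact n H :=
  match n with
  | S ?m => first [exact H | weaken_exact m (Tm_weaken _ _ H)]
  end.

Ltac def_step :=
  cbv beta;
  match goal with
  | |- Def1 _ => intros ? ? ?
  | |- Def2 _ => intros ? ? ? ? ?
  | H : Def1 ?P |- Def _ (fun e => ?P (@?f e)) => apply (H _ f)
  | H : Def2 ?P |- Def _ (fun e => ?P (@?f e) (@?g e)) => apply (H _ f g)
  | |- Tm _ (fun e => add (@?f e) (@?g e)) => apply (Tm_add _ f g)
  | |- Tm _ (fun e => mul (@?f e) (@?g e)) => apply (Tm_mul _ f g)
  | |- Tm _ (fun e => pair (@?f e) (@?g e)) => apply (Tm_pair _ f g)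
  | |- Tm _ (fun e => ?a) => apply (Tm_const _ a)
  | |- Tm _ (fun e => e ?i) => apply (Tm_var _ i); lia
  | H : Tm _ _ |- Tm _ _ => weaken_exact (6%nat) H
  | |- Def _ (fun e => ?Q) => apply (Def_prop _ Q)
  | |- Def _ (fun e => @?P e /\ @?Q e) => apply (Def_and _ P Q)
  | |- Def _ (fun e => @?P e \/ @?Q e) => apply (Def_or _ P Q)
  | |- Def _ (fun e => @?P e <-> @?Q e) => apply (Def_iff _ P Q)
  | |- Def _ (fun e => forall x, lt x (@?f e) -> @?Q e x) =>
      apply (Def_alllt _ f Q)
  | |- Def _ (fun e => exists x, lt x (@?f e) /\ @?Q e x) =>
      apply (Def_exlt _ f Q)
  | |- Def _ (fun e => exists x, List.In x ?L /\ @?Q e x) =>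
      apply (Def_exists_list _ L (fun x e => Q e x)); intro
  | |- Def _ (fun e => ~ (@?P e)) => apply (Def_not _ P)
  | |- Def _ (fun e => @?P e -> @?Q e) => apply (Def_imp _ P Q)
  | |- Def _ (fun e => (@?f e) = (@?g e)) => apply (Def_eq _ f g)
  | |- Def _ (fun e => lt (@?f e) (@?g e)) => apply (Def_lt _ f g)
  | |- Def _ (fun e => mem (@?f e) ?A) => apply (Def_mem _ f A)
  | |- _ => def_user
  end.

Ltac def := repeat def_step.

Section Schemes.
Context {M : L2_structure} {HM : RCA0 M}.

Lemma Def_formula (P : num M -> num M -> Prop) :
  Def2 P ->
  exists p s r, forall n x, P n x <-> sat s (scons x (scons n r)) p.
Proof.
  intros D; destruct (D 2 (fun e => e 1%nat) (fun e => e O) ltac:(def) ltac:(def) nil nil)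
    as (l & s1 & p & Hp).
  destruct (sets_nonempty M HM) as [A _].
  exists p, (prepend s1 (fun _ => A)), (prepend l (fun _ => 0)); intros n x.
  rewrite (Hp (fun _ => 0) (fun _ => A) (scons x (scons n (fun _ => 0)))).
  apply sat_ext; intros [|[|i]]; simpl; auto.
  unfold with_params; simpl. now rewrite ?Nat.sub_0_r.
Qed.

Lemma induction_sigma1 (P : num M -> num M -> Prop) :
  Def2 P ->
  (exists x, P 0 x) ->
  (forall n, (exists x, P n x) -> exists x, P (n + 1) x) ->
  forall n, exists x, P n x.
Proof.
  intros D; destruct (Def_formula P D) as (p & s & r & H); intros H0 HS n.
  assert (K : forall n, sigma1 s r p n <-> exists x, P n x).
  { intros m; split; intros (x & Hx); exists x; apply H; auto. }
  apply K, (RCA0_induction M HM); [apply K, H0|].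
  intros m Hm; apply K, HS, K, Hm.
Qed.

Lemma induction_def (P : num M -> Prop) :
  Def1 P ->
  P 0 -> (forall n, P n -> P (n + 1)) -> forall n, P n.
Proof.
  intros D H0 HS n.
  destruct (induction_sigma1 (fun n _ => P n) ltac:(def)) with n; auto.
  - now exists 0.
  - intros m (x & Hx); exists 0; auto.
Qed.

Lemma comprehension_delta1 (P Q : num M -> num M -> Prop) :
  Def2 P ->
  Def2 Q ->
  (forall n, (exists x, P n x) <-> (forall x, Q n x)) ->
  exists X : sets M, forall n, n in_ X <-> exists x, P n x.
Proof.
  intros DP DQ HPQ.
  destruct (DP 2 (fun e => e 1%nat) (fun e => e O) ltac:(def) ltac:(def) nil nil)
    as (l & s1 & p' & Hp').
  destruct (DQ 2 (fun e => e 1%nat) (fun e => e O) ltac:(def) ltac:(def) l s1)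
    as (l' & s2 & q' & Hq').
  destruct (sets_nonempty M HM) as [A _].
  set (s := prepend (s1 ++ s2) (fun _ => A)).
  set (r := prepend (l ++ l') (fun _ => 0)).
  assert (E : forall n x i,
      with_params 2 (scons x (scons n (fun _ => 0))) r i =
      scons x (scons n r) i).
  { intros n x [|[|i]]; simpl; auto.
    unfold with_params; simpl; now rewrite ?Nat.sub_0_r. }
  assert (KP : forall n x, P n x <-> sat s (scons x (scons n r)) p').
  { intros n x; rewrite <- (sat_ext _ _ _ _ (E n x)).
    unfold s, r; rewrite !prepend_app.
    apply (Hp' _ _ (scons x (scons n (fun _ => 0)))). }
  assert (KQ : forall n x, Q n x <-> sat s (scons x (scons n r)) q').
  { intros n x; rewrite <- (sat_ext _ _ _ _ (E n x)).
    apply (Hq' _ _ (scons x (scons n (fun _ => 0)))). }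
  destruct (RCA0_comprehension M HM p' q' s r) as (X & HX).
  - intros n; unfold sigma1, pi1; setoid_rewrite <- KP.
    setoid_rewrite <- KQ; auto.
  - exists X; intros n; rewrite HX; unfold sigma1.
    now setoid_rewrite <- KP.
Qed.

Lemma comprehension_def (P : num M -> Prop) :
  Def1 P -> exists X : sets M, forall n, n in_ X <-> P n.
Proof.
  intros D; destruct (comprehension_delta1 (fun n _ => P n) (fun n _ => P n))
    as (X & HX); [def|def| |].
  - intros n; split; [intros (_ & H); auto | intros H; exists 0; apply (H 0)].
  - exists X; intros n; rewrite HX; split;
      [intros (_ & H); auto | intros H; exists 0; auto].
Qed.
End Schemes.

(** * Arithmetic *)

Section Arithmetic.
Context {M : L2_structure} {HM : RCA0 M}.
Implicit Types a b c i j k m n x y z : num M.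

Let B : basic_axioms M := RCA0_basic M HM.

Lemma zero_add n : 0 + n = n.
Proof.
  revert n; apply induction_def; [def| |].
  - apply (add_0 M B).
  - intros n IH; now rewrite (add_succ M B), IH.
Qed.

Lemma succ_add m n : (m + 1) + n = (m + n) + 1.
Proof.
  revert n; apply induction_def; [def| |].
  - now rewrite !(add_0 M B).
  - intros n IH; now rewrite !(add_succ M B), IH.
Qed.

Lemma add_comm m n : m + n = n + m.
Proof.
  revert n; apply induction_def; [def| |].
  - now rewrite (add_0 M B), zero_add.
  - intros n IH; now rewrite (add_succ M B), succ_add, IH.
Qed.

Lemma add_assoc m n k : m + (n + k) = (m + n) + k.
Proof.
  revert k; apply induction_def; [def| |].
  - now rewrite !(add_0 M B).
  - intros k IH; now rewrite !(add_succ M B), IH.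
Qed.

Lemma zero_mul n : 0 * n = 0.
Proof.
  revert n; apply induction_def; [def| |].
  - apply (mul_0 M B).
  - intros n IH; now rewrite (mul_succ M B), IH, (add_0 M B).
Qed.

Lemma succ_mul m n : (m + 1) * n = m * n + n.
Proof.
  revert n; apply induction_def; [def| |].
  - now rewrite !(mul_0 M B), (add_0 M B).
  - intros n IH; rewrite !(mul_succ M B), IH, !(add_succ M B).
    f_equal; rewrite <- !add_assoc; f_equal; apply add_comm.
Qed.

Lemma mul_comm m n : m * n = n * m.
Proof.
  revert n; apply induction_def; [def| |].
  - now rewrite (mul_0 M B), zero_mul.
  - intros n IH; now rewrite (mul_succ M B), succ_mul, IH.
Qed.

Lemma mul_add_distr_r m n k : (m + n) * k = m * k + n * k.
Proof.
  revert k; apply induction_def; [def| |].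
  - now rewrite !(mul_0 M B), (add_0 M B).
  - intros k IH; rewrite !(mul_succ M B), IH, <- !add_assoc; f_equal.
    rewrite !add_assoc; f_equal; apply add_comm.
Qed.

Lemma mul_assoc m n k : m * (n * k) = (m * n) * k.
Proof.
  revert k; apply induction_def; [def| |].
  - now rewrite !(mul_0 M B).
  - intros k IH.
    rewrite !(mul_succ M B), <- IH, (mul_comm m (n * k + n)),
      mul_add_distr_r, (mul_comm m (n * k)), (mul_comm m n).
    reflexivity.
Qed.

Lemma one_mul n : 1 * n = n.
Proof.
  rewrite mul_comm; rewrite <- (zero_add 1) at 1.
  now rewrite (mul_succ M B), (mul_0 M B), zero_add.
Qed.

Lemma num_semi_ring :
  semi_ring_theory (0 : num M) 1 (@add M) (@mul M) (@eq (num M)).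
Proof.
  constructor; intros; auto using zero_add, add_comm, add_assoc, one_mul,
    zero_mul, mul_comm, mul_assoc, mul_add_distr_r.
Qed.

Add Ring num_ring : num_semi_ring.

Lemma add_cancel_r a b c : a + c = b + c -> a = b.
Proof.
  revert c; apply (induction_def (fun c => a + c = b + c -> a = b)); [def| |].
  - now rewrite !(add_0 M B).
  - intros c IH H; apply IH, (succ_inj M B).
    rewrite !add_assoc in H; exact H.
Qed.

Lemma add_cancel_l a b c : c + a = c + b -> a = b.
Proof. rewrite !(add_comm c); apply add_cancel_r. Qed.

Lemma lt_succ_diag n : n < n + 1.
Proof. apply (lt_succ M B); auto. Qed.

Lemma le_zero n : 0 <= n.
Proof.
  revert n; apply (induction_def (fun n => 0 <= n)); [def|auto|].
  intros n H; left; apply (lt_succ M B); auto.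
Qed.

Lemma zero_or_succ n : n = 0 \/ exists m, n = m + 1.
Proof.
  destruct (induction_sigma1 (fun n x => n = 0 \/ n = x + 1)) with n
    as (x & [H|H]); [def|now exists 0; left| |auto|eauto].
  intros m _; exists m; auto.
Qed.

Lemma lt_exists_add m n : m < n <-> exists k, n = m + (k + 1).
Proof.
  split.
  - intros H.
    destruct (induction_sigma1 (fun n k => m < n -> n = m + (k + 1))) with n
      as (k & Hk); [def| | |eauto].
    + exists 0; intros K; now apply (not_lt_0 M B) in K.
    + intros l (k & Hk); destruct (classic (m < l)) as [K|K].
      * exists (k + 1); intros _; rewrite (Hk K) at 1; ring.
      * exists 0; intros K'; apply (lt_succ M B) in K' as [K'| ->];
          [tauto|ring].
  - intros (k & ->); revert k.
    apply (induction_def (fun k => m < m + (k + 1))); [def| |].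
    + rewrite zero_add; apply lt_succ_diag.
    + intros k IH; replace (m + (k + 1 + 1)) with (m + (k + 1) + 1) by ring.
      apply (lt_succ M B); auto.
Qed.

Lemma le_exists_add m n : m <= n <-> exists k, n = m + k.
Proof.
  split.
  - intros [H| ->]; [apply lt_exists_add in H as (k & ->); eauto|].
    exists 0; ring.
  - intros (k & ->); destruct (zero_or_succ k) as [->|(j & ->)].
    + right; ring.
    + left; apply lt_exists_add; eauto.
Qed.

Lemma lt_irrefl n : ~ n < n.
Proof.
  intros H; apply lt_exists_add in H as (k & H).
  apply (succ_neq0 M B k), (add_cancel_l _ _ n); rewrite <- H; ring.
Qed.

Lemma lt_trans a b c : a < b -> b < c -> a < c.
Proof.
  rewrite !lt_exists_add; intros (k & ->) (j & ->).
  exists (k + 1 + j); ring.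
Qed.

Lemma le_lt_trans a b c : a <= b -> b < c -> a < c.
Proof. intros [H| ->]; eauto using lt_trans. Qed.

Lemma lt_le_trans a b c : a < b -> b <= c -> a < c.
Proof. intros H [K| <-]; eauto using lt_trans. Qed.

Lemma le_trans a b c : a <= b -> b <= c -> a <= c.
Proof. intros H [K| <-]; [left; eapply le_lt_trans; eauto|auto]. Qed.

Lemma le_antisym a b : a <= b -> b <= a -> a = b.
Proof.
  intros [H|H] K; auto.
  destruct (lt_irrefl a); eapply lt_le_trans; eauto.
Qed.

Lemma lt_not_le a b : a < b -> ~ b <= a.
Proof. intros H K; apply (lt_irrefl a); eapply lt_le_trans; eauto. Qed.

Lemma succ_le m n : m + 1 <= n <-> m < n.
Proof.
  rewrite le_exists_add, lt_exists_add.
  split; intros (k & ->); exists k; ring.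
Qed.

Lemma lt_succ_le m n : m < n + 1 <-> m <= n.
Proof. apply (lt_succ M B). Qed.

Lemma le_or_lt a b : a <= b \/ b < a.
Proof.
  revert a.
  apply (induction_def (fun a => a <= b \/ b < a)); [def| |].
  - left; apply le_zero.
  - intros a [H|H].
    + destruct H as [H| ->]; [left; now apply succ_le|].
      right; apply lt_succ_diag.
    + right; eapply lt_trans; eauto using lt_succ_diag.
Qed.

Lemma le_total a b : a <= b \/ b <= a.
Proof. destruct (le_or_lt a b); auto. Qed.

Lemma not_lt_zero n : ~ n < 0.
Proof. apply (not_lt_0 M B). Qed.

Lemma zero_lt n : n <> 0 -> 0 < n.
Proof. destruct (le_zero n); congruence. Qed.

Lemma succ_nonzero n : n + 1 <> 0.
Proof. apply (succ_neq0 M B). Qed.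

Lemma one_nonzero : (1 : num M) <> 0.
Proof. rewrite <- (zero_add 1); apply succ_nonzero. Qed.

Lemma succ_injective m n : m + 1 = n + 1 -> m = n.
Proof. apply (succ_inj M B). Qed.

Lemma le_add_r a b : a <= a + b.
Proof. apply le_exists_add; eauto. Qed.

Lemma add_le_mono a b c d : a <= b -> c <= d -> a + c <= b + d.
Proof.
  rewrite !le_exists_add; intros (k & ->) (j & ->); exists (k + j); ring.
Qed.

Lemma mul_le_mono a b c d : a <= b -> c <= d -> a * c <= b * d.
Proof.
  rewrite !le_exists_add; intros (k & ->) (j & ->).
  exists (k * c + a * j + k * j); ring.
Qed.

Lemma le_mul_nonzero_r a b : b <> 0 -> a <= a * b.
Proof.
  intros H; destruct (zero_or_succ b) as [->|(k & ->)]; [easy|].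
  apply le_exists_add; exists (a * k); ring.
Qed.

Lemma mul_nonzero a b : a <> 0 -> b <> 0 -> a * b <> 0.
Proof.
  intros Ha Hb E; destruct (le_mul_nonzero_r a b Hb) as [H|H].
  - rewrite E in H; now apply not_lt_zero in H.
  - congruence.
Qed.

Lemma mul_cancel_l a b c : a <> 0 -> a * b = a * c -> b = c.
Proof.
  intros Ha; assert (K : forall b c, b < c -> a * b <> a * c).
  { intros x y H E; apply lt_exists_add in H as (k & ->).
    apply (mul_nonzero a (k + 1) Ha (succ_nonzero k)).
    apply (add_cancel_l _ _ (a * x)).
    transitivity (a * (x + (k + 1))); [ring|rewrite <- E; ring]. }
  intros E; destruct (le_or_lt b c) as [[H|H]|H]; auto;
    exfalso; eapply K; eauto.
Qed.

Lemma pair_mono i i' j j' : i <= i' -> j <= j' -> pair i j <= pair i' j'.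
Proof. intros; unfold pair; auto using add_le_mono, mul_le_mono. Qed.

Lemma pair_lt_next i j : pair i j < (i + j + 1) * (i + j + 1).
Proof.
  unfold pair; apply lt_exists_add; exists (i + j + j); ring.
Qed.

Lemma pair_injective i j i' j' : pair i j = pair i' j' -> i = i' /\ j = j'.
Proof.
  assert (K : forall i j i' j', pair i j = pair i' j' -> i + j <= i' + j').
  { clear i j i' j'; intros i j i' j' E.
    destruct (le_or_lt (i + j) (i' + j')) as [H|H]; auto; exfalso.
    apply (lt_irrefl (pair i' j')).
    apply lt_le_trans with ((i' + j' + 1) * (i' + j' + 1));
      [apply pair_lt_next|].
    rewrite <- E; unfold pair.
    apply le_trans with ((i + j) * (i + j)); [|apply le_add_r].
    apply succ_le in H; auto using mul_le_mono. }
  intros E.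
  assert (S : i + j = i' + j') by (apply le_antisym; apply K; auto).
  unfold pair in E; rewrite S in E; apply add_cancel_l in E as ->.
  split; auto; eapply add_cancel_l; eauto.
Qed.

Lemma le_pair_l i j : i <= pair i j.
Proof. unfold pair; rewrite add_comm; apply le_add_r. Qed.

Lemma le_pair_r i j : j <= pair i j.
Proof.
  destruct (zero_or_succ j) as [->|(k & ->)]; [apply le_zero|].
  apply le_exists_add; unfold pair.
  exists (i * i + i + i + i * k + (i * k + k * k) + i + k); ring.
Qed.

Lemma pair_lt_inv i j n : pair i j < n -> i < n /\ j < n.
Proof.
  intros H; split; eapply le_lt_trans; [apply le_pair_l|exact H| |exact H].
  apply le_pair_r.
Qed.

Lemma least_element (P : num M -> Prop) :
  Def1 P -> (exists n, P n) ->
  exists n, P n /\ forall m, m < n -> ~ P m.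
Proof.
  intros D (n & Hn); apply NNPP; intros N.
  assert (K : forall k, forall m, m < k -> ~ P m).
  { apply (induction_def (fun k => forall m, m < k -> ~ P m)); [def| |].
    - intros m Hm; now apply not_lt_zero in Hm.
    - intros k IH m Hm; apply lt_succ_le in Hm as [Hm| ->]; auto.
      intros Hk; apply N; exists k; auto. }
  apply (K (n + 1) n); auto using lt_succ_diag.
Qed.

End Arithmetic.

(** * Divisibility and coding of finite sets *)

Section Divisibility.
Context {M : L2_structure} {HM : RCA0 M}.
Implicit Types a b c d i j k m n q x y z : num M.
Add Ring num_ring : (num_semi_ring (M := M)).

Definition divides a b : Prop := exists q, b = q * a.

Lemma Def_divides (k : nat) (f g : (nat -> num M) -> num M) :
  Tm k f -> Tm k g -> Def k (fun e => divides (f e) (g e)).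
Proof.
  intros F G.
  apply Def_ext with (fun e => exists q, q < g e + 1 /\ g e = q * f e);
    [|def].
  intros e; split; intros (q & H); [|exists q; tauto].
  destruct (classic (f e = 0)) as [Z|Z].
  - exists 0; split; [apply lt_succ_le, le_zero|].
    rewrite H, Z; ring.
  - exists q; split; auto. apply lt_succ_le; rewrite H.
    now apply le_mul_nonzero_r.
Qed.

Lemma divides_mul_l a b : divides a (b * a).
Proof. exists b; auto. Qed.

Lemma divides_trans a b c : divides a b -> divides b c -> divides a c.
Proof. intros (q & ->) (p & ->); exists (p * q); ring. Qed.

Lemma divides_mul a b c : divides a b -> divides a (c * b).
Proof. intros (q & ->); exists (c * q); ring. Qed.

Lemma divides_add_cancel a x y :
  divides a x -> divides a (x + y) -> divides a y.
Proof.
  intros (p & ->) (q & H).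
  destruct (le_total p q) as [K|K]; apply le_exists_add in K as (k & ->).
  - exists k; apply (add_cancel_l _ _ (p * a)); rewrite H; ring.
  - exists 0; destruct (zero_or_succ y) as [->|(z & ->)]; [ring|].
    exfalso; apply (succ_nonzero (k * a + z)), (add_cancel_l _ _ (q * a)).
    transitivity ((q + k) * a + (z + 1)); [ring|]. rewrite H; ring.
Qed.

Lemma division n d : d <> 0 -> exists q r, r < d /\ n = q * d + r.
Proof.
  intros Hd; revert n.
  apply (induction_sigma1 (fun n q => exists r, r < d /\ n = q * d + r));
    [def| |].
  - exists 0, 0; split; [now apply zero_lt|ring].
  - intros n (q & r & Hr & ->); apply succ_le in Hr as [Hr|Hr].
    + exists q, (r + 1); split; auto; ring.
    + exists (q + 1), 0; split; [now apply zero_lt|]. rewrite <- Hr; ring.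
Qed.

Lemma divides_one a : divides a 1 -> a = 1.
Proof.
  intros (q & H); apply le_antisym.
  - rewrite H, mul_comm; apply le_mul_nonzero_r; intros ->.
    apply one_nonzero; rewrite H; ring.
  - destruct (zero_or_succ a) as [->|(k & ->)].
    + exfalso; apply one_nonzero; rewrite H; ring.
    + rewrite add_comm; apply le_add_r.
Qed.

Definition coprime a b : Prop := forall e, divides e a -> divides e b -> e = 1.

(** The least [c > 0] with [a | b * c] divides every such [c], in particular
    [a] itself; if [a = e * c], then [e] divides [b]. *)
Lemma coprime_divides_mul a b c :
  a <> 0 -> coprime a b -> divides a (b * c) -> divides a c.
Proof.
  intros Ha Hab Hc.
  destruct (least_element (fun c => c <> 0 /\ divides a (b * c)))
    as (c' & (Hc' & Hd) & Hmin).
  { intros k f F.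
    apply (Def_and k (fun e => f e <> 0) (fun e => divides a (b * f e)));
      [def|apply (Def_divides k (fun _ => a) (fun e => b * f e)); def]. }
  { exists a; split; auto using divides_mul_l. }
  assert (K : forall x, divides a (b * x) -> divides c' x).
  { intros x Hx; destruct (division x c' Hc') as (q & r & Hr & ->).
    destruct (classic (r = 0)) as [->|Z]; [exists q; ring|].
    destruct (Hmin r Hr); split; auto.
    apply divides_add_cancel with (q * (b * c')); [now apply divides_mul|].
    now replace (q * (b * c') + b * r) with (b * (q * c' + r)) by ring. }
  destruct (K a) as (e & He); [apply divides_mul_l|].
  assert (e = 1) as ->.
  { apply Hab; [exists c'; rewrite He; ring|].
    destruct Hd as (t & Ht); exists t.
    apply (mul_cancel_l c'); auto.
    transitivity (b * c'); [ring|]; rewrite Ht, He; ring. }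
  replace a with c' by (rewrite He; ring); auto.
Qed.

End Divisibility.

Ltac def_user ::=
  match goal with
  | |- Def _ (fun e => divides (@?f e) (@?g e)) => apply (Def_divides _ f g)
  end.

Section Coding.
Context {M : L2_structure} {HM : RCA0 M}.
Implicit Types a b c d i j k m n q x y z B N : num M.
Add Ring num_ring : (num_semi_ring (M := M)).

Lemma common_multiple (f : num M -> num M) :
  (forall (k : nat) g, Tm k g -> Tm k (fun e => f (g e))) ->
  (forall i, f i <> 0) ->
  forall n, exists N, N <> 0 /\ forall i, i < n -> divides (f i) N.
Proof.
  intros F Hf.
  apply (induction_sigma1
    (fun n N => N <> 0 /\ forall i, i < n -> divides (f i) N)).
  - intros k g h G H.
    assert (F' : Tm (S k) (fun e => f (e O))) by (apply F; def).
    def.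
  - exists 1; split; [apply one_nonzero|].
    intros i K; now apply not_lt_zero in K.
  - intros n (N & HN & H); exists (f n * N); split; [now apply mul_nonzero|].
    intros i Hi; apply lt_succ_le in Hi as [Hi| ->].
    + now apply divides_mul, H.
    + exists N; ring.
Qed.

Definition modulus m i : num M := m * (i + 1) + 1.

Lemma in_fin_pair i k m n :
  in_fin i (pair k (pair m n)) <-> i < k /\ divides (modulus m i) n.
Proof.
  split.
  - intros (k' & m' & n' & E & H & D).
    apply pair_injective in E as (-> & E).
    apply pair_injective in E as (-> & ->); auto.
  - intros (H & D); exists k, m, n; auto.
Qed.

Lemma in_fin_lt i c : in_fin i c -> i < c.
Proof.
  intros (k & m & n & -> & H & _); eapply lt_le_trans; eauto using le_pair_l.
Qed.

Lemma modulus_coprime m n i j :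
  i < n -> j < n -> i <> j -> (forall i, i < n -> divides (i + 1) m) ->
  coprime (modulus m i) (modulus m j).
Proof.
  intros Hi Hj Hij Hm.
  assert (K : forall i j, i < j -> j < n ->
    coprime (modulus m i) (modulus m j)).
  { clear i j Hi Hj Hij; intros i j Hij Hj e Di Dj.
    apply lt_exists_add in Hij as (t & ->).
    assert (Dt : divides e (t + 1)).
    { apply divides_add_cancel with ((i + 1) * modulus m (i + (t + 1)));
        [now apply divides_mul|].
      replace (_ + _) with ((i + (t + 1) + 1) * modulus m i)
        by (unfold modulus; ring).
      now apply divides_mul. }
    apply divides_one, divides_add_cancel with (m * (i + 1)); auto.
    rewrite mul_comm; apply divides_mul, divides_trans with (t + 1); auto.
    apply Hm; eapply le_lt_trans; [|exact Hj].
    apply le_exists_add; exists (i + 1); ring. }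
  destruct (le_or_lt i j) as [[H|H]|H]; [|easy|]; auto.
  intros e Di Dj; eapply (K j i); eauto.
Qed.

(** [B] bounds the codes of all definable subsets of [{i | i < n}]. *)
Definition is_bound n B : Prop :=
  exists m N, B = pair n (pair m N) /\ m <> 0 /\ N <> 0 /\
    (forall i, i < n -> divides (i + 1) m) /\
    (forall i, i < n -> divides (modulus m i) N).

Lemma exists_bound n : exists B, is_bound n B.
Proof.
  destruct (common_multiple (fun i => i + 1)) with n as (m & Hm & Dm).
  { intros k g G; def. }
  { intros i; apply succ_nonzero. }
  destruct (common_multiple (modulus m)) with n as (N & HN & DN).
  { intros k g G; unfold modulus; def. }
  { intros i; apply succ_nonzero. }
  exists (pair n (pair m N)), m, N; auto.
Qed.

(** The code is [(n, (m, L))] for the least common multiple [L] of the moduli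
    of the elements: since the moduli are pairwise coprime, the quotient of
    [L] by the modulus of a non-element would be a smaller common multiple. *)
Lemma bounded_coding (P : num M -> Prop) n B :
  Def1 P -> is_bound n B ->
  exists m L, pair n (pair m L) <= B /\
    forall i, in_fin i (pair n (pair m L)) <-> i < n /\ P i.
Proof.
  intros D (m & N & -> & Hm & HN & Dm & DN).
  destruct (least_element (fun L => L <> 0 /\
    forall i, i < n -> P i -> divides (modulus m i) L))
    as (L & (HL & DL) & Hmin).
  { unfold modulus; def. }
  { exists N; auto. }
  exists m, L; split.
  - apply pair_mono; auto; apply pair_mono; auto.
    destruct (le_or_lt L N) as [H|H]; auto.
    destruct (Hmin N H); auto.
  - intros i; rewrite in_fin_pair; split; [|intros (Hi & H); auto].
    intros (Hi & q & Hq); split; auto; apply NNPP; intros NP.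
    assert (Hq0 : q <> 0) by (intros ->; apply HL; rewrite Hq; ring).
    apply (Hmin q).
    + rewrite Hq; unfold modulus.
      destruct (zero_or_succ (q * (m * (i + 1)))) as [Z|(z & Z)].
      * destruct (mul_nonzero q (m * (i + 1))); auto.
        apply mul_nonzero; auto using succ_nonzero.
      * apply lt_exists_add; exists z; rewrite <- Z; ring.
    + split; auto; intros j Hj Pj.
      apply coprime_divides_mul with (modulus m i).
      * apply succ_nonzero.
      * eapply modulus_coprime; eauto; intros ->; auto.
      * rewrite mul_comm, <- Hq; auto.
Qed.

Lemma Def_in_fin (k : nat) (f g : (nat -> num M) -> num M) :
  Tm k f -> Tm k g -> Def k (fun e => in_fin (f e) (g e)).
Proof.
  intros F G.
  apply Def_ext with (fun e => exists k, k < g e + 1 /\ exists m, m < g e + 1 /\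
    exists n, n < g e + 1 /\ (g e = pair k (pair m n) /\ f e < k /\
      divides (m * (f e + 1) + 1) n)); [|def].
  intros e; split.
  - intros (k' & m & n & E & H & K).
    exists k'; split; [apply lt_succ_le; rewrite E; apply le_pair_l|].
    exists m; split; [apply lt_succ_le; rewrite E|
      exists n; split; [apply lt_succ_le; rewrite E|auto]].
    + eapply le_trans; [apply le_pair_l|apply le_pair_r].
    + eapply le_trans; [apply le_pair_r|apply le_pair_r].
  - intros (k' & _ & m & _ & n & _ & H); exists k', m, n; auto.
Qed.

Lemma Def_is_bound (k : nat) (f g : (nat -> num M) -> num M) :
  Tm k f -> Tm k g -> Def k (fun e => is_bound (f e) (g e)).
Proof.
  intros F G.
  apply Def_ext with (fun e => exists m, m < g e + 1 /\
    exists N, N < g e + 1 /\ (g e = pair (f e) (pair m N) /\ m <> 0 /\ N <> 0 /\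
    (forall i, i < f e -> divides (i + 1) m) /\
    (forall i, i < f e -> divides (m * (i + 1) + 1) N))); [|def].
  intros e; split.
  - intros (m & N & E & H).
    exists m; split; [apply lt_succ_le; rewrite E|
      exists N; split; [apply lt_succ_le; rewrite E|auto]].
    + eapply le_trans; [apply le_pair_l|apply le_pair_r].
    + eapply le_trans; [apply le_pair_r|apply le_pair_r].
  - intros (m & _ & n & _ & H); exists m, n; auto.
Qed.

End Coding.

(** * From separation to paths *)

Ltac def_user ::=
  match goal with
  | |- Def _ (fun e => in_fin (@?f e) (@?g e)) => apply (Def_in_fin _ f g)
  | |- Def _ (fun e => is_bound (@?f e) (@?g e)) => apply (Def_is_bound _ f g)
  end.

Definition separation (M : L2_structure) : Prop :=
  forall A B : sets M,
    (forall x y y', pair x y in_ A -> pair x y' in_ A -> y = y') ->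
    (forall x y y', pair x y in_ B -> pair x y' in_ B -> y = y') ->
    (forall x y y', pair x y in_ A -> ~ pair x y' in_ B) ->
    exists X : sets M, forall x y,
      (pair x y in_ A -> x in_ X) /\ (pair x y in_ B -> ~ x in_ X).

Section Separation.
Context {M : L2_structure} {HM : RCA0 M}.
Implicit Types a b c d i j k m n q x y z B N : num M.

Lemma least_witness_graph (P : num M -> num M -> Prop) :
  Def2 P -> exists A : sets M,
    (forall x y, pair x y in_ A -> P x y) /\
    (forall x y y', pair x y in_ A -> pair x y' in_ A -> y = y') /\
    (forall x y, P x y -> exists y', pair x y' in_ A).
Proof.
  intros D.
  destruct (comprehension_def (fun p => exists x, x < p + 1 /\
    exists y, y < p + 1 /\ (p = pair x y /\ P x y /\
      forall z, z < y -> ~ P x z))) as (A & HA); [def|].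
  assert (K : forall x y, pair x y in_ A <->
      P x y /\ forall z, z < y -> ~ P x z).
  { intros x y; rewrite HA; split.
    - intros (x' & _ & y' & _ & E & H); apply pair_injective in E as (-> & ->).
      auto.
    - intros H; exists x; split; [apply lt_succ_le, le_pair_l|].
      exists y; split; [apply lt_succ_le, le_pair_r|auto]. }
  exists A; split; [|split].
  - intros x y H; now apply K in H.
  - intros x y y' H H'; apply K in H as (H & L), H' as (H' & L').
    destruct (le_or_lt y y') as [[C|C]|C]; auto; exfalso;
      [eapply L'|eapply L]; eauto.
  - intros x y H; destruct (least_element (P x)) as (y' & Hy'); [def|eauto|].
    exists y'; apply K, Hy'.
Qed.

Lemma separation_sigma1 (P Q : num M -> num M -> Prop) :
  separation M -> Def2 P -> Def2 Q ->
  (forall x y y', P x y -> ~ Q x y') ->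
  exists X : sets M, forall x y, (P x y -> x in_ X) /\ (Q x y -> ~ x in_ X).
Proof.
  intros S DP DQ H.
  destruct (least_witness_graph P DP) as (A & A1 & A2 & A3).
  destruct (least_witness_graph Q DQ) as (B & B1 & B2 & B3).
  destruct (S A B A2 B2) as (X & HX).
  - intros x y y' Hx Hy; eapply H; eauto.
  - exists X; intros x y; split; intros K.
    + apply A3 in K as (y' & K); eapply HX; eauto.
    + apply B3 in K as (y' & K); eapply HX; eauto.
Qed.

End Separation.

Section Paths.
Context {M : L2_structure} {HM : RCA0 M}.
Implicit Types c i j k l m n s x y z B : num M.

Definition agree l c c' : Prop :=
  forall i, i < l -> (in_fin i c <-> in_fin i c').

Lemma agree_refl l c : agree l c c.
Proof. intros i _; reflexivity. Qed.

Lemma agree_sym l c c' : agree l c c' -> agree l c' c.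
Proof. intros H i Hi; symmetry; auto. Qed.

Lemma agree_trans l c c' c'' : agree l c c' -> agree l c' c'' -> agree l c c''.
Proof. intros H K i Hi; rewrite (H i Hi); auto. Qed.

Lemma agree_le l l' c c' : l' <= l -> agree l c c' -> agree l' c c'.
Proof. intros H K i Hi; apply K; eapply lt_le_trans; eauto. Qed.

Lemma agree_succ l c c' :
  agree l c c' -> (in_fin l c <-> in_fin l c') -> agree (l + 1) c c'.
Proof. intros H K i Hi; apply lt_succ_le in Hi as [Hi| ->]; auto. Qed.

Lemma exists_agree_below n B c :
  is_bound n B -> exists c', c' < B + 1 /\ agree n c c'.
Proof.
  intros HB; destruct (bounded_coding (fun i => in_fin i c) n B)
    as (m & L & HL & H); auto; [def|].
  exists (pair n (pair m L)); split; [now apply lt_succ_le|].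
  intros i Hi; rewrite H; tauto.
Qed.

(** A separating set may treat two codes of the same string differently, so it
    is consulted at the least code only. *)
Definition canonical l c c' : Prop :=
  agree l c c' /\ forall x, x < c' -> ~ agree l c x.

Lemma canonical_exists l c : exists c', canonical l c c'.
Proof.
  apply least_element; [unfold agree; def|exists c; apply agree_refl].
Qed.

Lemma canonical_unique l c1 c2 c1' c2' :
  agree l c1 c2 -> canonical l c1 c1' -> canonical l c2 c2' -> c1' = c2'.
Proof.
  intros A (H1 & L1) (H2 & L2).
  destruct (le_or_lt c1' c2') as [[C|C]|C]; auto; exfalso.
  - apply (L2 _ C); eauto using agree_trans, agree_sym.
  - apply (L1 _ C); eauto using agree_trans, agree_sym.
Qed.

Section Query.
Context (X : sets M).

Definition query l c : Prop := exists c', canonical l c c' /\ pair l c' in_ X.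

Definition good l s : Prop := forall i, i < l -> (in_fin i s <-> query i s).

Lemma query_agree l c c' : agree l c c' -> (query l c <-> query l c').
Proof.
  assert (K : forall c c', agree l c c' -> query l c -> query l c').
  { intros c1 c2 A (c1' & H & Q).
    destruct (canonical_exists l c2) as (c2' & H2); exists c2'; split; auto.
    now rewrite <- (canonical_unique l c1 c2 c1' c2'). }
  intros A; split; apply K; auto using agree_sym.
Qed.

Lemma Def_good (k : nat) (f g : (nat -> num M) -> num M) :
  Tm k f -> Tm k g -> Def k (fun e => good (f e) (g e)).
Proof.
  intros F G; unfold good.
  apply Def_ext with (fun e => forall i, i < f e ->
    (in_fin i (g e) <-> exists c, c < g e + 1 /\ (canonical i (g e) c /\
      pair i c in_ X))); [|unfold canonical, agree; def].
  intros e.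
  assert (K : forall i, query i (g e) <->
    exists c, c < g e + 1 /\ (canonical i (g e) c /\ pair i c in_ X)).
  { intros i; split.
    - intros (c & H & Hc); exists c; split; auto; apply lt_succ_le.
      destruct (le_or_lt c (g e)) as [L|L]; auto.
      destruct H as (_ & H); destruct (H _ L); apply agree_refl.
    - intros (c & _ & H); exists c; auto. }
  now setoid_rewrite K.
Qed.

Lemma good_exists l : exists s, good l s.
Proof.
  revert l; apply induction_sigma1.
  { intros k f g F G; now apply Def_good. }
  { exists 0; intros i Hi; now apply not_lt_zero in Hi. }
  intros l (s & Hs); destruct (exists_bound (l + 1)) as (B & HB).
  destruct (bounded_coding (fun i => (i < l /\ in_fin i s) \/ (i = l /\ query l s))
    (l + 1) B) as (m & L & _ & H); [def|auto|].
  set (s' := pair (l + 1) (pair m L)) in *; exists s'.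
  assert (A : agree l s s').
  { intros i Hi; rewrite H; split.
    - intros K; split; auto; apply lt_succ_le; auto.
    - intros (_ & [K|(-> & _)]); [tauto|now apply lt_irrefl in Hi]. }
  intros i Hi; apply lt_succ_le in Hi as [Hi| ->].
  - rewrite <- (A i Hi), (Hs i Hi); apply query_agree.
    apply agree_le with l; auto.
  - rewrite H, <- (query_agree l s s' A); split.
    + intros (_ & [(K & _)|K]); [now apply lt_irrefl in K|tauto].
    + intros K; split; auto; apply lt_succ_diag.
Qed.

Lemma good_agree l l' s s' : l <= l' -> good l s -> good l' s' -> agree l s s'.
Proof.
  intros Hl H H'.
  assert (K : forall k, k <= l -> agree k s s').
  { apply (induction_def (fun k => k <= l -> agree k s s'));
      [unfold agree; def| |].
    - intros _ i Hi; now apply not_lt_zero in Hi.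
    - intros k IH Hk; apply succ_le in Hk.
      assert (A : agree k s s') by auto.
      apply agree_succ; auto.
      rewrite (H k Hk), (H' k (lt_le_trans _ _ _ Hk Hl)).
      now apply query_agree. }
  auto.
Qed.

Lemma good_limit : exists G : sets M, forall l s j,
  good l s -> j < l -> (j in_ G <-> in_fin j s).
Proof.
  assert (K : forall j l s s', good l s -> j < l -> good (j + 1) s' ->
      (in_fin j s <-> in_fin j s')).
  { intros j l s s' H Hj H'; symmetry; apply (good_agree (j + 1) l); auto.
    - now apply succ_le.
    - apply lt_succ_diag. }
  destruct (comprehension_delta1 (fun j s => good (j + 1) s /\ in_fin j s)
    (fun j s => good (j + 1) s -> in_fin j s)) as (G & HG).
  - intros k f g F1 F2.
    apply (Def_and k (fun e => good (f e + 1) (g e))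
      (fun e => in_fin (f e) (g e))); [apply (Def_good k (fun e => f e + 1) g)|];
      def.
  - intros k f g F1 F2.
    apply (Def_imp k (fun e => good (f e + 1) (g e))
      (fun e => in_fin (f e) (g e))); [apply (Def_good k (fun e => f e + 1) g)|];
      def.
  - intros j; split.
    + intros (s & H & Hs) s' H'; apply (K j (j + 1) s); auto using lt_succ_diag.
    + intros H; destruct (good_exists (j + 1)) as (s & Hs); exists s; auto.
  - exists G; intros l s j Hs Hj; rewrite HG; split.
    + intros (s' & H & Hs'); now apply (K j l s s').
    + intros H; destruct (good_exists (j + 1)) as (s' & Hs'); exists s'.
      split; auto; now apply (K j l s s').
Qed.
End Query.

(** The elements [pair n c] of [W] are the strings of length [n] on a binary
    tree, coded with repetitions by the numbers [c]. *)
Lemma path_of_separation (W : sets M) :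
  separation M ->
  (forall n c c', agree n c c' -> pair n c in_ W -> pair n c' in_ W) ->
  (forall n n' c, n' <= n -> pair n c in_ W -> pair n' c in_ W) ->
  (forall n, exists c, pair n c in_ W) ->
  exists G : sets M, forall n, exists c, pair n c in_ W /\
    forall j, j < n -> (in_fin j c <-> j in_ G).
Proof.
  intros Sep W1 W2 W3.
  set (bit := fun (b : bool) i c => if b then in_fin i c else ~ in_fin i c).
  set (ext := fun (b : bool) n B i c => exists c', c' < B + 1 /\
    (pair n c' in_ W /\ agree i c c' /\ bit b i c')).
  assert (Hext : forall b n B i c c', is_bound n B -> i < n ->
    pair n c' in_ W -> agree i c c' -> bit b i c' -> ext b n B i c).
  { intros b n B i c c' HB Hi Hc' A Hb.
    destruct (exists_agree_below n B c' HB) as (c'' & L & A').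
    exists c''; split; auto; split; [now apply (W1 n c')|split].
    - apply agree_trans with c'; auto; apply agree_le with n; auto.
    - destruct b; simpl in *; now rewrite <- (A' i Hi). }
  set (theta := fun (b : bool) x y => exists i, i < x + 1 /\
    exists c, c < x + 1 /\ exists n, n < y + 1 /\ exists B, B < y + 1 /\
    (x = pair i c /\ y = pair n B /\ is_bound n B /\ i < n /\
      ext b n B i c /\ ~ ext (negb b) n B i c)).
  assert (Dtheta : forall b, Def2 (theta b)).
  { intros [|]; unfold theta, ext, bit, agree; simpl; def. }
  assert (Excl : forall b x y y', theta b x y -> ~ theta (negb b) x y').
  { assert (Key : forall b n B n' B' i c, n <= n' ->
      is_bound n B -> i < n -> ~ ext (negb b) n B i c ->
      ext (negb b) n' B' i c -> False).
    { intros b n B n' B' i c Hn HB Hi N (c' & _ & Hc' & A & Hb).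
      apply N, (Hext _ _ _ _ _ c'); auto; now apply (W2 n'). }
    intros b x y y'
      (i & _ & c & _ & n & _ & B & _ & -> & -> & HB & Hi & E & N)
      (i' & _ & c' & _ & n' & _ & B' & _ & Ex & -> & HB' & Hi' & E' & N').
    apply pair_injective in Ex as (<- & <-).
    rewrite Bool.negb_involutive in N'.
    destruct (le_total n n') as [L|L].
    - apply (Key b n B n' B' i c); auto.
    - apply (Key (negb b) n' B' n B i c); auto;
        now rewrite Bool.negb_involutive. }
  destruct (separation_sigma1 (theta true) (theta false)) as (X & HX); auto.
  { intros x y y'; apply Excl. }
  destruct (good_limit X) as (G & HG); exists G; intros n.
  destruct (good_exists X n) as (s & Hs).
  destruct (exists_bound n) as (B & HB).
  exists s; split; [|intros j Hj; symmetry; eapply HG; eauto].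
  (* The level [n] is fixed throughout the induction, so that the induction
     formula is bounded. *)
  assert (K : forall i, i <= n ->
    exists c, c < B + 1 /\ (pair n c in_ W /\ agree i s c)).
  { apply (induction_def (fun i => i <= n ->
      exists c, c < B + 1 /\ (pair n c in_ W /\ agree i s c)));
      [unfold agree; def| |].
    - intros _; destruct (W3 n) as (c & Hc).
      destruct (exists_agree_below n B c HB) as (c' & L & A).
      exists c'; split; auto; split; [now apply (W1 n c)|].
      intros i Hi; now apply not_lt_zero in Hi.
    - intros i IH Hi; apply succ_le in Hi.
      destruct IH as (c & Lc & Hc & A); auto.
      destruct (canonical_exists i s) as (c0 & H0).
      assert (HQ : in_fin i s <-> pair i c0 in_ X).
      { rewrite (Hs i Hi); split.
        - intros (c1 & H1 & Q).
          now rewrite (canonical_unique i s s c0 c1).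
        - intros Q; exists c0; auto. }
      assert (Hb : exists b, bit b i s).
      { destruct (classic (in_fin i s)); [exists true|exists false]; auto. }
      destruct Hb as (b & Hb).
      assert (E : ext b n B i c0).
      { apply NNPP; intros N.
        assert (T : theta (negb b) (pair i c0) (pair n B)).
        { exists i; split; [apply lt_succ_le, le_pair_l|].
          exists c0; split; [apply lt_succ_le, le_pair_r|].
          exists n; split; [apply lt_succ_le, le_pair_l|].
          exists B; split; [apply lt_succ_le, le_pair_r|].
          rewrite Bool.negb_involutive; repeat split; auto.
          assert (A0 : agree i c0 c)
            by (apply agree_trans with s; auto; apply agree_sym, H0).
          apply (Hext _ _ _ _ _ c); auto.
          destruct b; simpl in *.
          - intros C; apply N, (Hext _ _ _ _ _ c); auto.
          - apply NNPP; intros C; apply N, (Hext _ _ _ _ _ c); auto. }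
        destruct b; simpl in *; apply HX in T; tauto. }
      destruct E as (c' & L & Hc' & A' & Hb').
      exists c'; split; auto; split; auto; apply agree_succ.
      + apply agree_trans with c0; auto; apply H0.
      + destruct b; simpl in *; tauto. }
  destruct (K n) as (c & _ & Hc & A); auto.
  apply (W1 n c); auto using agree_sym.
Qed.

End Paths.

(** * Sequences and trees *)

Section Sequences.
Context {M : L2_structure} {HM : RCA0 M}.
Implicit Types c i j l m n p s t x y z B K : num M.
Add Ring num_ring : (num_semi_ring (M := M)).

Lemma Def_is_fin_code (k : nat) (f : (nat -> num M) -> num M) :
  Tm k f -> Def k (fun e => is_fin_code (f e)).
Proof.
  intros F; unfold is_fin_code.
  apply Def_ext with (fun e =>
    (exists k, k < f e + 1 /\ exists m, m < f e + 1 /\ exists n, n < f e + 1 /\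
       f e = pair k (pair m n)) /\
    (forall k, k < f e -> forall m, m < f e -> forall n, n < f e ->
       pair k (pair m n) < f e ->
       ~ (forall i, i < f e ->
            (in_fin i (pair k (pair m n)) <-> in_fin i (f e))))); [|def].
  intros e; set (c := f e); clearbody c.
  assert (L2 : forall k' m n, m <= pair k' (pair m n))
    by (intros; eapply le_trans; [apply le_pair_l|apply le_pair_r]).
  assert (L3 : forall k' m n, n <= pair k' (pair m n))
    by (intros; eapply le_trans; [apply le_pair_r|apply le_pair_r]).
  split; intros (H1 & H2); split.
  - destruct H1 as (k' & m & n & ->).
    exists k'; split; [apply lt_succ_le, le_pair_l|].
    exists m; split; [apply lt_succ_le, L2|].
    exists n; split; [apply lt_succ_le, L3|auto].
  - intros k' _ m _ n _ H E; apply (H2 k' m n H); intros i.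
    split; intros Hi; apply E; auto.
    + apply lt_trans with (pair k' (pair m n)); auto using in_fin_lt.
    + auto using in_fin_lt.
  - destruct H1 as (k' & _ & m & _ & n & _ & H); eauto.
  - intros k' m n H E; apply (H2 k') with m n; auto.
    + now apply pair_lt_inv in H.
    + eapply le_lt_trans; [apply L2|exact H].
    + eapply le_lt_trans; [apply L3|exact H].
Qed.

Lemma Def_is_seq (k : nat) (f g : (nat -> num M) -> num M) :
  Tm k f -> Tm k g -> Def k (fun e => is_seq (f e) (g e)).
Proof.
  intros F G; unfold is_seq.
  apply Def_ext with (fun e => is_fin_code (f e) /\
    (forall p, p < f e -> in_fin p (f e) ->
       exists i, i < p + 1 /\ exists j, j < p + 1 /\ p = pair i j) /\
    (forall i, i < f e -> forall j, j < f e -> forall j', j' < f e ->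
       in_fin (pair i j) (f e) -> in_fin (pair i j') (f e) -> j = j') /\
    (forall i, i < g e + f e ->
       (i < g e <-> exists j, j < f e /\ in_fin (pair i j) (f e)))).
  - intros e; set (s := f e); set (l := g e); clearbody s l.
    assert (A : forall i j, in_fin (pair i j) s -> i < s /\ j < s).
    { intros i j H; now apply pair_lt_inv, in_fin_lt. }
    assert (H4 : (forall i, i < l <-> exists j, in_fin (pair i j) s) <->
      (forall i, i < l + s ->
        (i < l <-> exists j, j < s /\ in_fin (pair i j) s))).
    { split.
      - intros H i _; rewrite H; split; intros (j & Hj); exists j; [|tauto].
        split; auto; now apply A in Hj.
      - intros H i; split.
        + intros Hi; apply H in Hi as (j & Hj); [exists j; tauto|].
          eapply lt_le_trans; eauto using le_add_r.
        + intros (j & Hj); pose proof (A i j Hj) as (Hi & Hj').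
          apply H; [|eauto].
          eapply lt_le_trans; [exact Hi|]; rewrite add_comm; apply le_add_r. }
    rewrite H4; split; intros (H1 & H2 & H3 & H5); split; auto; split.
    + intros p _ Hp; destruct (H2 p Hp) as (i & j & ->).
      exists i; split; [apply lt_succ_le, le_pair_l|].
      exists j; split; [apply lt_succ_le, le_pair_r|auto].
    + split; auto; intros; eauto.
    + intros p Hp; destruct (H2 p) as (i & _ & j & _ & ->);
        eauto using in_fin_lt.
    + split; auto; intros i j j' Hj Hj'.
      pose proof (A i j Hj) as (Hi & Lj); pose proof (A i j' Hj') as (_ & Lj').
      apply (H3 i Hi j Lj j'); auto.
  - def; now apply Def_is_fin_code.
Qed.

Lemma fin_code_exists (P : num M -> Prop) K :
  Def1 P ->
  exists t, is_fin_code t /\ forall i, in_fin i t <-> i < K /\ P i.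
Proof.
  intros D; destruct (exists_bound K) as (B & HB).
  destruct (bounded_coding P K B D HB) as (m & L & _ & HL).
  assert (E : forall c, (forall i, in_fin i c <-> i < K /\ P i) <->
    (forall i, i < c + K -> (in_fin i c <-> i < K /\ P i))).
  { intros c; split; [auto|intros H i; split; intros Hi].
    - apply H; auto; apply lt_le_trans with c; auto using in_fin_lt, le_add_r.
    - apply H; auto; apply lt_le_trans with K; [tauto|].
      rewrite add_comm; apply le_add_r. }
  destruct (least_element (fun c => (exists k, k < c + 1 /\ exists m, m < c + 1 /\
      exists n, n < c + 1 /\ c = pair k (pair m n)) /\
    (forall i, i < c + K -> (in_fin i c <-> i < K /\ P i))))
    as (t & (Ht1 & Ht2) & Hmin); [def| |].
  { exists (pair K (pair m L)); split; [|now apply E].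
    exists K; split; [apply lt_succ_le, le_pair_l|].
    exists m; split; [apply lt_succ_le; eapply le_trans;
      [apply le_pair_l|apply le_pair_r]|].
    exists L; split; [apply lt_succ_le; eapply le_trans;
      [apply le_pair_r|apply le_pair_r]|auto]. }
  pose proof (proj2 (E t) Ht2) as Ht2'; clear Ht2.
  exists t; split; auto; split.
  - destruct Ht1 as (k & _ & m' & _ & n & _ & ->); eauto.
  - intros k' m' n' Hlt Heq; apply (Hmin _ Hlt); split.
    + exists k'; split; [apply lt_succ_le, le_pair_l|].
      exists m'; split; [apply lt_succ_le; eapply le_trans;
        [apply le_pair_l|apply le_pair_r]|].
      exists n'; split; [apply lt_succ_le; eapply le_trans;
        [apply le_pair_r|apply le_pair_r]|auto].
    + apply E; intros i; rewrite Heq; apply Ht2'.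
Qed.

Lemma fin_code_le_bound t K B :
  is_fin_code t -> (forall i, in_fin i t -> i < K) -> is_bound K B -> t <= B.
Proof.
  intros (_ & Hmin) HK HB.
  destruct (bounded_coding (fun i => in_fin i t) K B)
    as (m & L & HL & H); auto; [def|].
  destruct (le_or_lt t B) as [C|C]; auto; exfalso.
  apply (Hmin K m L).
  - eapply le_lt_trans; eauto.
  - intros i; rewrite H; split; [tauto|auto].
Qed.

Lemma fin_code_unique t t' :
  is_fin_code t -> is_fin_code t' ->
  (forall i, in_fin i t <-> in_fin i t') -> t = t'.
Proof.
  assert (A : forall t t', is_fin_code t -> is_fin_code t' ->
    (forall i, in_fin i t <-> in_fin i t') -> ~ t < t').
  { intros x x' ((k & m & n & ->) & _) (_ & H') E L; now apply (H' k m n). }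
  intros H H' E; destruct (le_or_lt t t') as [[C|C]|C]; auto; exfalso.
  - eapply (A t t'); eauto.
  - eapply (A t' t); eauto; intros i; symmetry; auto.
Qed.

Definition represents t n c : Prop :=
  is_seq t n /\ (forall i j, in_fin (pair i j) t -> j = 0 \/ j = 1) /\
  (forall i, i < n -> (in_fin (pair i 1) t <-> in_fin i c)).

Lemma Def_represents (k : nat) (f g h : (nat -> num M) -> num M) :
  Tm k f -> Tm k g -> Tm k h -> Def k (fun e => represents (f e) (g e) (h e)).
Proof.
  intros F G H; unfold represents.
  apply Def_ext with (fun e => is_seq (f e) (g e) /\
    (forall i, i < f e -> forall j, j < f e ->
       in_fin (pair i j) (f e) -> j = 0 \/ j = 1) /\
    (forall i, i < g e -> (in_fin (pair i 1) (f e) <-> in_fin i (h e)))).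
  - intros e; split; intros (H1 & H2 & H3); split; auto; split; auto.
    + eauto.
    + intros i j Hij; pose proof (in_fin_lt _ _ Hij) as L.
      apply pair_lt_inv in L as (Li & Lj); apply (H2 i); auto.
  - apply (Def_and k (fun e => is_seq (f e) (g e))); [now apply Def_is_seq|].
    def.
Qed.

Ltac def_user ::=
  match goal with
  | |- Def _ (fun e => in_fin (@?f e) (@?g e)) => apply (Def_in_fin _ f g)
  | |- Def _ (fun e => represents (@?f e) (@?g e) (@?h e)) =>
      apply (Def_represents _ f g h)
  end.

Lemma represents_iff t n c p :
  represents t n c ->
  (in_fin p t <-> exists i j, p = pair i j /\ i < n /\
     ((j = 1 /\ in_fin i c) \/ (j = 0 /\ ~ in_fin i c))).
Proof.
  intros ((_ & H2 & H3 & H4) & Hb & Hc); split.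
  - intros Hp; destruct (H2 p Hp) as (i & j & ->); exists i, j; split; auto.
    assert (Hi : i < n) by (apply H4; eauto); split; auto.
    rewrite <- (Hc i Hi).
    destruct (Hb i j Hp) as [-> | ->]; [right|left]; auto; split; auto.
    intros K; now apply one_nonzero, (H3 i).
  - intros (i & j & -> & Hi & [(-> & H)|(-> & H)]); [now apply Hc|].
    destruct (proj1 (H4 i) Hi) as (j & Hj).
    destruct (Hb i j Hj) as [-> | ->]; auto.
    destruct H; now apply Hc.
Qed.

Lemma represents_exists n c : exists t, represents t n c.
Proof.
  destruct (fin_code_exists (fun p => exists i, i < p + 1 /\
    exists j, j < p + 1 /\ (p = pair i j /\ i < n /\
      ((j = 1 /\ in_fin i c) \/ (j = 0 /\ ~ in_fin i c)))) (pair n 1 + 1))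
    as (t & Ht1 & Ht2); [def|].
  assert (E : forall i j, in_fin (pair i j) t <-> i < n /\
    ((j = 1 /\ in_fin i c) \/ (j = 0 /\ ~ in_fin i c))).
  { intros i j; rewrite Ht2; split.
    - intros (_ & i' & _ & j' & _ & Ep & H).
      apply pair_injective in Ep as (-> & ->); auto.
    - intros (Hi & H); split.
      + apply lt_succ_le, pair_mono; auto.
        destruct H as [(-> & _)|(-> & _)]; auto using le_zero.
      + exists i; split; [apply lt_succ_le, le_pair_l|].
        exists j; split; [apply lt_succ_le, le_pair_r|auto]. }
  exists t; repeat split.
  - apply Ht1.
  - apply Ht1.
  - intros p Hp; apply Ht2 in Hp as (_ & i & _ & j & _ & -> & _); eauto.
  - intros i j j' H H'; apply E in H as (_ & H), H' as (_ & H').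
    destruct H as [(-> & H)|(-> & H)], H' as [(-> & H')|(-> & H')]; tauto.
  - intros Hi; destruct (classic (in_fin i c)); [exists 1|exists 0];
      apply E; auto.
  - intros (j & Hj); now apply E in Hj.
  - intros i j H; apply E in H as (_ & [(-> & _)|(-> & _)]); auto.
  - intros H'; apply E in H' as (_ & [H'|(H' & _)]); [tauto|].
    now apply one_nonzero in H'.
  - intros H'; apply E; auto.
Qed.

Lemma represents_agree t n c c' :
  agree n c c' -> represents t n c -> represents t n c'.
Proof.
  intros A (H1 & H2 & H3); split; auto; split; auto.
  intros i Hi; rewrite (H3 i Hi); auto.
Qed.

Lemma represents_unique t t' n c :
  represents t n c -> represents t' n c -> t = t'.
Proof.
  intros H H'; apply fin_code_unique; [apply H|apply H'|].
  intros p; now rewrite (represents_iff t n c), (represents_iff t' n c).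
Qed.

Lemma binary_seq_represents t :
  is_binary_seq t -> exists n c, represents t n c.
Proof.
  intros (n & Hn & Hb); destruct (exists_bound n) as (B & HB).
  destruct (bounded_coding (fun i => in_fin (pair i 1) t) n B)
    as (m & L & _ & H); auto; [def|].
  exists n, (pair n (pair m L)); split; auto; split; auto.
  intros i Hi; rewrite H; tauto.
Qed.

Lemma represents_initial_segment t t' n n' c :
  n' <= n -> represents t n c -> represents t' n' c -> initial_segment t' t.
Proof.
  intros L H H'; exists n', n; split; [apply H'|split; [apply H|split; auto]].
  intros i j Hij; rewrite (represents_iff t' n' c) in Hij; auto.
  destruct Hij as (i' & j' & E & Hi & K).
  rewrite (represents_iff t n c); auto; exists i', j'.
  split; auto; split; auto; eapply lt_le_trans; eauto.
Qed.

Lemma WKL_of_separation : separation M -> WKL M.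
Proof.
  intros Sep T (Tb & Tc) Tinf.
  destruct (comprehension_delta1
    (fun p t => exists n, n < p + 1 /\ exists c, c < p + 1 /\
      (p = pair n c /\ represents t n c /\ t in_ T))
    (fun p t => exists n, n < p + 1 /\ exists c, c < p + 1 /\
      (p = pair n c /\ (represents t n c -> t in_ T)))) as (W & HW);
    [def|def| |].
  { intros p; split.
    - intros (t & n & Ln & c & Lc & -> & Ht & HT) t'.
      exists n; split; auto; exists c; split; auto; split; auto.
      intros Ht'; now rewrite (represents_unique t' t n c).
    - intros H; destruct (H 0) as (n & Ln & c & Lc & -> & _).
      destruct (represents_exists n c) as (t & Ht); exists t.
      exists n; split; auto; exists c; split; auto; split; auto; split; auto.
      destruct (H t) as (n' & _ & c' & _ & E & K).
      apply pair_injective in E as (<- & <-); auto. }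
  assert (HW' : forall n c, pair n c in_ W <->
    exists t, represents t n c /\ t in_ T).
  { intros n c; rewrite HW; split.
    - intros (t & n' & _ & c' & _ & E & H).
      apply pair_injective in E as (<- & <-); eauto.
    - intros (t & H); exists t, n; split; [apply lt_succ_le, le_pair_l|].
      exists c; split; [apply lt_succ_le, le_pair_r|auto]. }
  assert (W2 : forall n n' c, n' <= n -> pair n c in_ W -> pair n' c in_ W).
  { intros n n' c L H; apply HW' in H as (t & Ht & HT); apply HW'.
    destruct (represents_exists n' c) as (t' & Ht'); exists t'; split; auto.
    apply Tc with t; auto; eapply represents_initial_segment; eauto. }
  destruct (path_of_separation W) as (G & HG); auto.
  - intros n c c' A H; apply HW' in H as (t & Ht & HT); apply HW'.
    exists t; split; auto; eapply represents_agree; eauto.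
  - intros n; destruct (exists_bound (pair n 1 + 1)) as (B & HB).
    destruct (Tinf B) as (t & Lt & HT).
    destruct (binary_seq_represents t) as (l & c & Ht); auto.
    exists c; apply W2 with l; [|apply HW'; eauto].
    destruct (le_or_lt n l) as [C|C]; auto; exfalso.
    apply (lt_not_le _ _ Lt), (fin_code_le_bound t (pair n 1 + 1)); auto.
    + apply Ht.
    + intros p Hp; rewrite (represents_iff t l c) in Hp; auto.
      destruct Hp as (i & j & -> & Hi & Hj).
      apply lt_succ_le, pair_mono; [left; eapply lt_trans; eauto|].
      destruct Hj as [(-> & _)|(-> & _)]; auto using le_zero.
  - destruct (comprehension_def (fun p => exists i, i < p + 1 /\
      exists j, j < p + 1 /\ (p = pair i j /\
        ((j = 1 /\ i in_ G) \/ (j = 0 /\ ~ i in_ G))))) as (g & Hg); [def|].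
    assert (Hg' : forall i j, pair i j in_ g <->
      (j = 1 /\ i in_ G) \/ (j = 0 /\ ~ i in_ G)).
    { intros i j; rewrite Hg; split.
      - intros (i' & _ & j' & _ & E & H).
        apply pair_injective in E as (<- & <-); auto.
      - intros H; exists i; split; [apply lt_succ_le, le_pair_l|].
        exists j; split; [apply lt_succ_le, le_pair_r|auto]. }
    exists g; split; [split|].
    + intros p Hp; apply Hg in Hp as (i & _ & j & _ & -> & _); eauto.
    + intros i _; destruct (classic (i in_ G)) as [C|C].
      * exists 1; split; [apply Hg'; auto|].
        intros j Hj; apply Hg' in Hj as [(-> & _)|(_ & Hj)]; tauto.
      * exists 0; split; [apply Hg'; auto|].
        intros j Hj; apply Hg' in Hj as [(_ & Hj)|(-> & _)]; tauto.
    + intros n; destruct (HG n) as (c & Hc & HcG).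
      apply HW' in Hc as (t & Ht & HT); exists t; split; auto.
      split; [apply Ht|]; intros i j Hij; apply Hg'.
      rewrite (represents_iff t n c) in Hij; auto.
      destruct Hij as (i' & j' & E & Hi & H).
      apply pair_injective in E as (<- & <-).
      now rewrite <- (HcG i Hi).
Qed.

End Sequences.

(** * Gadgets *)

Lemma finite_choice {A : Type} (a : A) (R : nat -> A -> Prop) (n : nat) :
  (forall t, (t < n)%nat -> exists x, R t x) ->
  exists f, forall t, (t < n)%nat -> R t (f t).
Proof.
  induction n as [|n IH]; intros H.
  - exists (fun _ => a); lia.
  - destruct IH as (f & Hf); [auto with arith|].
    destruct (H n) as (x & Hx); [lia|].
    exists (fun t => if (t =? n)%nat then x else f t); intros t Ht.
    destruct (Nat.eqb_spec t n) as [->|N]; auto; apply Hf; lia.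
Qed.

Lemma filter_length_lt {A : Type} (f : A -> bool) (l : list A) (a : A) :
  List.In a l -> f a = false -> (length (filter f l) < length l)%nat.
Proof.
  induction l as [|b l IH]; simpl; [easy|]; intros [->|H] Ha.
  - rewrite Ha; pose proof (filter_length_le f l); lia.
  - specialize (IH H Ha); destruct (f b); simpl; lia.
Qed.

Section Cardinality.
Context {M : L2_structure} {HM : RCA0 M}.

Lemma numeral_lt (m n : nat) : (m < n)%nat -> (numeral m : num M) < numeral n.
Proof.
  induction 1; simpl; [apply lt_succ_diag|].
  eapply lt_trans; eauto using lt_succ_diag.
Qed.

Lemma numeral_injective (m n : nat) : (numeral m : num M) = numeral n -> m = n.
Proof.
  intros E; destruct (Nat.lt_trichotomy m n) as [H|[H|H]]; auto;
    apply numeral_lt in H; rewrite E in H; now apply lt_irrefl in H.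
Qed.

Lemma below_numeral (n : nat) (x : num M) :
  below (numeral n) x <-> exists i, (i < n)%nat /\ x = numeral i.
Proof.
  split; [|intros (i & H & ->); now apply numeral_lt].
  unfold below; induction n as [|n IH]; simpl; intros H.
  - now apply not_lt_zero in H.
  - apply lt_succ_le in H as [H| ->]; [|eauto].
    destruct (IH H) as (i & Hi & ->); eauto.
Qed.

Lemma has_card_list (P : num M -> Prop) (l : list (num M)) :
  NoDup l -> (forall x, P x <-> List.In x l) -> has_card P (numeral (length l)).
Proof.
  intros N HP.
  destruct (comprehension_def (fun p => exists i, List.In i (seq 0 (length l)) /\
    p = pair (numeral i) (nth i l 0))) as (f & Hf); [def|].
  assert (K : forall i, (i < length l)%nat -> pair (numeral i) (nth i l 0) in_ f).
  { intros i Hi; apply Hf; exists i; split; auto; apply in_seq; lia. }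
  assert (K' : forall (i : nat) x, pair (numeral i) x in_ f -> x = nth i l 0).
  { intros i x H; apply Hf in H as (j & _ & E).
    apply pair_injective in E as (E & ->).
    now apply numeral_injective in E as ->. }
  exists f; split; [split|split].
  - intros p Hp; apply Hf in Hp as (i & Hi & ->); apply in_seq in Hi.
    exists (numeral i), (nth i l 0); split; [apply numeral_lt; lia|].
    split; auto; apply HP, nth_In; lia.
  - intros x Hx; apply below_numeral in Hx as (i & Hi & ->).
    exists (nth i l 0); split; auto.
    intros y Hy; symmetry; auto.
  - intros x y z Hx Hy; pose proof Hx as Hx'; pose proof Hy as Hy'.
    apply Hf in Hx' as (i & Hi & E); apply pair_injective in E as (-> & ->).
    apply Hf in Hy' as (j & Hj & E); apply pair_injective in E as (-> & E).
    apply in_seq in Hi, Hj; f_equal.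
    apply (proj1 (NoDup_nth l 0) N); auto; lia.
  - intros x Hx; apply HP, (In_nth l x 0) in Hx as (i & Hi & <-); eauto.
Qed.

Lemma list_of_has_card (P : num M -> Prop) (n : nat) :
  has_card P (numeral n) ->
  exists l, NoDup l /\ length l = n /\ forall x, List.In x l -> P x.
Proof.
  intros (f & (F1 & F2) & Inj & _).
  destruct (finite_choice (0 : num M) (fun i x => pair (numeral i) x in_ f) n)
    as (g & Hg).
  { intros i Hi; destruct (F2 (numeral i)) as (x & Hx & _); eauto.
    now apply numeral_lt. }
  exists (map g (seq 0 n)); split; [|split].
  - apply NoDup_map_NoDup_ForallPairs; [|apply seq_NoDup].
    intros i j Hi Hj E; apply in_seq in Hi, Hj.
    apply numeral_injective, (Inj _ _ (g i)); [|rewrite E]; apply Hg; lia.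
  - now rewrite length_map, length_seq.
  - intros x Hx; apply in_map_iff in Hx as (i & <- & Hi); apply in_seq in Hi.
    destruct (F1 (pair (numeral i) (g i))) as (j & y & _ & Hy & E);
      [apply Hg; lia|].
    now apply pair_injective in E as (_ & ->).
Qed.

End Cardinality.

(** The vertices of a gadget are numbered by [t < d + 2]; the vertices [t >= 3]
    form a [(d - 1)]-clique that is joined to the vertices 0 and [hub b]. So a
    [d]-coloring gives the same color to 0 and [hub b]; it gives the same color
    to 0 and 1 if [b] is false, and different ones if [b] is true because of
    the additional edge between 1 and 2. *)
Definition hub (b : bool) : nat := if b then 2 else 1.

Definition gadget (b : bool) (t u : nat) : bool :=
  ((3 <=? t) && (3 <=? u) && negb (t =? u)
   || (3 <=? t) && ((u =? 0) || (u =? hub b))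
   || (3 <=? u) && ((t =? 0) || (t =? hub b))
   || b && ((t =? 1) && (u =? 2) || (t =? 2) && (u =? 1)))%nat%bool.

Lemma gadget_sym (b : bool) (t u : nat) : gadget b t u = gadget b u t.
Proof.
  destruct t as [|[|[|t]]], u as [|[|[|u]]], b; try reflexivity;
    unfold gadget; simpl; now rewrite (Nat.eqb_sym t u).
Qed.

Lemma gadget_irrefl (b : bool) (t : nat) : gadget b t t = false.
Proof.
  destruct b, t as [|[|[|t]]]; auto; unfold gadget; simpl;
    now rewrite Nat.eqb_refl.
Qed.

Lemma gadget_ge2 (b : bool) (t u : nat) :
  gadget b t u = true -> (2 <= t \/ 2 <= u)%nat.
Proof.
  destruct t as [|[|t]]; [| |lia]; (destruct u as [|[|u]]; [| |lia]);
    destruct b; discriminate.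
Qed.

Definition gadget_neighbours (d : nat) (b : bool) (t : nat) : list nat :=
  filter (gadget b t) (seq 0 (d + 2)).

Lemma in_gadget_neighbours (d : nat) (b : bool) (t u : nat) :
  List.In u (gadget_neighbours d b t) <->
  (u < d + 2)%nat /\ gadget b t u = true.
Proof.
  unfold gadget_neighbours; rewrite filter_In, in_seq; intuition lia.
Qed.

Lemma gadget_neighbours_split (d : nat) (b : bool) (t : nat) :
  (1 <= d)%nat ->
  gadget_neighbours d b t =
  filter (gadget b t) [0; 1; 2]%nat ++ filter (gadget b t) (seq 3 (d - 1)).
Proof.
  intros Hd; unfold gadget_neighbours.
  replace (d + 2)%nat with (3 + (d - 1))%nat by lia.
  now rewrite seq_app, filter_app.
Qed.

Lemma clique_filter_none (d : nat) (b : bool) (t : nat) :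
  (t = 1 /\ b = true \/ t = 2 /\ b = false)%nat ->
  filter (gadget b t) (seq 3 (d - 1)) = [].
Proof.
  intros Ht; destruct (filter _ _) as [|u l] eqn:E; auto.
  assert (H : List.In u (filter (gadget b t) (seq 3 (d - 1))))
    by (rewrite E; now left).
  apply filter_In in H as (Hu & H); apply in_seq in Hu.
  destruct u as [|[|[|u]]]; try lia.
  destruct Ht as [(-> & ->)|(-> & ->)]; discriminate.
Qed.

Lemma gadget_degree_low (d : nat) (b : bool) (t : nat) :
  (2 <= d)%nat -> (t < 2)%nat -> (length (gadget_neighbours d b t) < d)%nat.
Proof.
  intros Hd Ht; rewrite gadget_neighbours_split, length_app by lia.
  pose proof (filter_length_le (gadget b t) (seq 3 (d - 1))) as L.
  rewrite length_seq in L.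
  destruct t as [|[|t]], b; try lia; simpl in *; try lia.
  rewrite clique_filter_none; simpl; lia.
Qed.

Lemma gadget_degree_le (d : nat) (b : bool) (t : nat) :
  (2 <= d)%nat -> (t < d + 2)%nat ->
  (length (gadget_neighbours d b t) <= d)%nat.
Proof.
  intros Hd Ht; rewrite gadget_neighbours_split, length_app by lia.
  pose proof (filter_length_le (gadget b t) (seq 3 (d - 1))) as L.
  rewrite length_seq in L.
  destruct t as [|[|[|t]]], b; simpl in *; try lia.
  all: pose proof (filter_length_lt (gadget true (S (S (S t))))
         (seq 3 (d - 1)) (S (S (S t)))) as L1.
  all: pose proof (filter_length_lt (gadget false (S (S (S t))))
         (seq 3 (d - 1)) (S (S (S t)))) as L2.
  all: rewrite length_seq, in_seq, gadget_irrefl in L1, L2.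
  all: specialize (L1 ltac:(lia) eq_refl); specialize (L2 ltac:(lia) eq_refl).
  all: lia.
Qed.

Lemma gadget_degree_clique (d : nat) (b : bool) :
  (2 <= d)%nat -> length (gadget_neighbours d b 3) = d.
Proof.
  intros Hd; rewrite gadget_neighbours_split, length_app by lia.
  replace (d - 1)%nat with (S (d - 2)) by lia; simpl seq.
  change (filter (gadget b 3) (3%nat :: seq 4 (d - 2)))
    with (if gadget b 3 3 then 3%nat :: filter (gadget b 3) (seq 4 (d - 2))
          else filter (gadget b 3) (seq 4 (d - 2))).
  rewrite gadget_irrefl, (forallb_filter_id _ (seq 4 _)), length_seq.
  - destruct b; simpl; lia.
  - apply forallb_forall; intros u Hu; apply in_seq in Hu.
    destruct u as [|[|[|[|u]]]]; try lia; reflexivity.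
Qed.

Lemma gadget_low_neighbour (d : nat) (b : bool) (t : nat) :
  (2 <= d)%nat -> (t < d + 2)%nat ->
  length (gadget_neighbours d b t) = d ->
  exists u, (u < 2)%nat /\ gadget b t u = true.
Proof.
  intros Hd Ht L; destruct t as [|[|[|t]]].
  - pose proof (gadget_degree_low d b 0 Hd); lia.
  - pose proof (gadget_degree_low d b 1 Hd); lia.
  - destruct b; [exists 1%nat; auto|].
    rewrite gadget_neighbours_split, clique_filter_none in L by auto with arith.
    simpl in L; lia.
  - exists 0%nat; split; auto with arith; destruct b; reflexivity.
Qed.

Lemma gadget_adjacent (d : nat) (b : bool) (t u : nat) :
  List.In t (0%nat :: hub b :: seq 3 (d - 1)) ->
  List.In u (0%nat :: hub b :: seq 3 (d - 1)) ->
  t <> u -> gadget b t u = false ->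
  t = 0%nat /\ u = hub b \/ t = hub b /\ u = 0%nat.
Proof.
  intros Ht Hu N G; simpl in Ht, Hu; rewrite in_seq in Ht, Hu.
  destruct b; simpl in *; destruct t as [|[|[|t]]], u as [|[|[|u]]];
    try lia; try discriminate; unfold gadget in G; simpl in G;
    apply Bool.orb_false_iff in G as (G & _);
    destruct (Nat.eqb_spec t u); try discriminate; lia.
Qed.

(** * Separation from Brooks' theorem *)

Definition vertex {M : L2_structure} (x s : num M) (t : nat) : num M :=
  pair (numeral t) (if (t <? 2)%nat then x else s).

Lemma Tm_vertex {M : L2_structure} (k : nat) (f g : (nat -> num M) -> num M)
    (t : nat) :
  Tm k f -> Tm k g -> Tm k (fun e => vertex (f e) (g e) t).
Proof. intros F G; unfold vertex; destruct (t <? 2)%nat; def. Qed.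

Ltac def_user ::=
  match goal with
  | |- Tm _ (fun e => vertex (@?f e) (@?g e) ?t) => apply (Tm_vertex _ f g t)
  end.

Section GadgetGraph.
Context {M : L2_structure} {HM : RCA0 M}.
Context (d : nat) (hd : (2 <= d)%nat).
Context (S : bool -> sets M).
Context (S_functional : forall b x y y',
  pair x y in_ S b -> pair x y' in_ S b -> y = y').
Context (S_disjoint : forall x y y',
  pair x y in_ S true -> ~ pair x y' in_ S false).

Lemma gadget_unique (b b' : bool) (x y y' : num M) :
  pair x y in_ S b -> pair x y' in_ S b' -> b = b' /\ y = y'.
Proof.
  intros H H'; destruct b, b'; split; eauto;
    exfalso; eapply S_disjoint; eauto.
Qed.

Definition edge (u v : num M) : Prop :=
  exists b t t' x y, (t < d + 2)%nat /\ (t' < d + 2)%nat /\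
    gadget b t t' = true /\ pair x y in_ S b /\
    u = vertex x (pair x y) t /\ v = vertex x (pair x y) t'.

Lemma edge_sym (u v : num M) : edge u v -> edge v u.
Proof.
  intros (b & t & t' & x & y & Ht & Ht' & G & H & Eu & Ev).
  exists b, t', t, x, y; rewrite gadget_sym; auto 10.
Qed.

Lemma vertex_injective (x s x' s' : num M) (t t' : nat) :
  vertex x s t = vertex x' s' t' ->
  t = t' /\ ((t < 2)%nat /\ x = x' \/ (2 <= t)%nat /\ s = s').
Proof.
  intros E; apply pair_injective in E as (E & E').
  apply numeral_injective in E as <-; split; auto.
  destruct (Nat.ltb_spec t 2); auto.
Qed.

Lemma edge_irrefl (u : num M) : ~ edge u u.
Proof.
  intros (b & t & t' & x & y & _ & _ & G & _ & -> & E).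
  apply vertex_injective in E as (<- & _); now rewrite gadget_irrefl in G.
Qed.

Lemma edge_iff (b : bool) (x y : num M) (t : nat) (v : num M) :
  (t < d + 2)%nat -> pair x y in_ S b ->
  (edge (vertex x (pair x y) t) v <->
   List.In v (map (vertex x (pair x y)) (gadget_neighbours d b t))).
Proof.
  intros Ht HS; rewrite in_map_iff; split.
  - intros (b' & t1 & t' & x' & y' & Ht1 & Ht' & G & HS' & E & ->).
    apply vertex_injective in E as (<- & E).
    assert (x = x' /\ b = b' /\ y = y') as (<- & <- & <-).
    { destruct E as [(_ & <-)|(_ & E)].
      - split; auto; eapply gadget_unique; eauto.
      - apply pair_injective in E as (<- & <-).
        split; auto; eapply gadget_unique; eauto. }
    exists t'; split; auto; now apply in_gadget_neighbours.
  - intros (t' & <- & H); apply in_gadget_neighbours in H as (Ht' & G).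
    exists b, t, t', x, y; auto 10.
Qed.

Lemma edge_graph : exists G : graph M,
  (forall u, u in_ V G) /\ forall u v, adj G u v <-> edge u v.
Proof.
  destruct (comprehension_def (fun _ : num M => True)) as (U & HU); [def|].
  destruct (comprehension_def (fun p => exists b, List.In b [true; false] /\
    exists t, List.In t (seq 0 (d + 2)) /\
    exists t', List.In t' (seq 0 (d + 2)) /\ (gadget b t t' = true /\
    exists x, x < p + 1 /\ exists y, y < p + 1 /\ (pair x y in_ S b /\
      p = pair (vertex x (pair x y) t) (vertex x (pair x y) t')))))
    as (D & HD); [def|].
  assert (K : forall u v, pair u v in_ D <-> edge u v).
  { intros u v; rewrite HD; split.
    - intros (b & _ & t & Ht & t' & Ht' & G & x & _ & y & _ & H & E).
      apply pair_injective in E as (-> & ->).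
      apply in_seq in Ht, Ht'.
      exists b, t, t', x, y; repeat split; auto; lia.
    - intros (b & t & t' & x & y & Ht & Ht' & G & H & -> & ->).
      exists b; split; [destruct b; simpl; auto|].
      exists t; split; [apply in_seq; lia|].
      exists t'; split; [apply in_seq; lia|split; auto].
      assert (L : pair x y <=
          pair (vertex x (pair x y) t) (vertex x (pair x y) t')).
      { unfold vertex; destruct (gadget_ge2 b t t' G) as [C|C];
          apply Nat.ltb_ge in C; rewrite C;
          eapply le_trans; [apply le_pair_r|apply le_pair_l|
            apply le_pair_r|apply le_pair_r]. }
      exists x; split; [apply lt_succ_le; eapply le_trans;
        [apply le_pair_l|exact L]|].
      exists y; split; [apply lt_succ_le; eapply le_trans;
        [apply le_pair_r|exact L]|auto]. }
  unshelve eexists (Build_graph M U D _ _ _ _).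
  - exists 0; now apply HU.
  - intros p Hp; assert (Hp' := Hp).
    apply HD in Hp' as (b & _ & t & _ & t' & _ & _ & x & _ & y & _ & _ & ->).
    exists (vertex x (pair x y) t), (vertex x (pair x y) t').
    repeat split; now apply HU.
  - intros u v H; apply K, edge_sym, K, H.
  - intros u H; apply K in H; now apply edge_irrefl in H.
  - split; [intros u; now apply HU|exact K].
Qed.

Definition neighbours (u : num M) (l : list (num M)) : Prop :=
  NoDup l /\ forall v, edge u v <-> List.In v l.

Lemma gadget_vertex_neighbours (b : bool) (x y : num M) (t : nat) :
  (t < d + 2)%nat -> pair x y in_ S b ->
  neighbours (vertex x (pair x y) t)
    (map (vertex x (pair x y)) (gadget_neighbours d b t)).
Proof.
  intros Ht H; split; [|intros v; now apply edge_iff].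
  apply NoDup_map_NoDup_ForallPairs.
  - intros i j _ _ E; now apply vertex_injective in E.
  - apply NoDup_filter, seq_NoDup.
Qed.

Lemma neighbours_exist (u : num M) :
  exists l, neighbours u l /\ (length l <= d)%nat /\
    (length l = d -> exists w l',
       edge u w /\ neighbours w l' /\ (length l' < d)%nat).
Proof.
  destruct (classic (exists v, edge u v)) as [(v & H)|N].
  - destruct H as (b & t & _ & x & y & Ht & _ & _ & H & -> & _).
    exists (map (vertex x (pair x y)) (gadget_neighbours d b t)).
    split; [now apply gadget_vertex_neighbours|rewrite length_map].
    split; [now apply gadget_degree_le|]; intros L.
    destruct (gadget_low_neighbour d b t) as (t' & Ht' & G); auto.
    assert (Ht'' : (t' < d + 2)%nat) by lia.
    exists (vertex x (pair x y) t'),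
      (map (vertex x (pair x y)) (gadget_neighbours d b t')).
    split; [exists b, t, t', x, y; auto 10|].
    split; [now apply gadget_vertex_neighbours|].
    rewrite length_map; now apply gadget_degree_low.
  - exists nil; split; [split|split]; simpl; auto using NoDup_nil with arith.
    + intros v; split; [intros H; apply N; eauto|easy].
    + lia.
Qed.

Lemma no_full_subgraph (C : num M -> Prop) (u : num M) :
  C u ->
  (forall v, C v -> exists l, NoDup l /\ length l = d /\
     forall w, List.In w l -> C w /\ edge v w) -> False.
Proof.
  intros Hu HC.
  destruct (neighbours_exist u) as (l & (Nl & Hl) & Ll & Hlow).
  destruct (HC u Hu) as (k & Nk & Lk & Hk).
  assert (I : incl k l) by (intros w Hw; now apply Hl, Hk).
  destruct Hlow as (w & l' & Huw & (Nl' & Hl') & Ll').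
  - pose proof (NoDup_incl_length Nk I); lia.
  - assert (Cw : C w).
    { apply Hk, (NoDup_length_incl Nk (l' := l)); auto; [lia|now apply Hl]. }
    destruct (HC w Cw) as (k' & Nk' & Lk' & Hk').
    assert (I' : incl k' l') by (intros v Hv; now apply Hl', Hk').
    pose proof (NoDup_incl_length Nk' I'); lia.
Qed.

Lemma no_clique (G : graph M) (K : sets M) :
  (forall u v, adj G u v <-> edge u v) ->
  ~ is_clique G (numeral (Datatypes.S d)) K.
Proof.
  intros HG (HK & _ & Hadj).
  apply list_of_has_card in HK as (l & Nl & Ll & Hl).
  destruct l as [|u l]; [discriminate|].
  apply (no_full_subgraph (fun v => List.In v (u :: l)) u); [now left|].
  intros v Hv; apply in_split in Hv as (l1 & l2 & E).
  rewrite E in *; exists (l1 ++ l2).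
  assert (N : NoDup (l1 ++ l2) /\ ~ List.In v (l1 ++ l2))
    by (now apply NoDup_remove).
  split; [apply N|split].
  - rewrite length_app in *; simpl in Ll; lia.
  - intros w Hw.
    assert (Hw' : List.In w (l1 ++ v :: l2))
      by (apply in_app_iff in Hw; apply in_app_iff; simpl; tauto).
    split; auto; apply HG, Hadj; auto.
    + apply Hl, in_app_iff; simpl; auto.
    + intros ->; tauto.
Qed.

Lemma no_odd_cycle (G : graph M) (n : num M) (c : sets M) :
  d = 2%nat -> (forall u v, adj G u v <-> edge u v) ->
  odd n -> ~ is_cycle G n c.
Proof.
  intros D HG (h & Hn) ((F1 & F2) & Inj & Hadj & (m & x & y & Em & Hx & Hy & Hxy)).
  destruct (zero_or_succ h) as [->|(h' & ->)].
  { rewrite (add_0 M (RCA0_basic M HM)) in Hn.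
    rewrite Hn in Em; apply succ_injective in Em as <-.
    destruct (F2 0) as (z & _ & Hz).
    - unfold below; rewrite Hn; apply lt_succ_diag.
    - rewrite <- (Hz x Hx), <- (Hz y Hy) in Hxy; now apply HG, edge_irrefl in Hxy. }
  assert (Hm : exists k, m = k + 1 /\ k <> 0).
  { exists (h' + 1 + h'); split.
    - apply succ_injective; rewrite <- Em, Hn, !add_assoc; reflexivity.
    - rewrite (add_comm (h' + 1)), add_assoc; apply succ_nonzero. }
  destruct Hm as (k & Em' & Hk).
  assert (adj_sym : forall u v, adj G u v -> adj G v u)
    by (intros u v; apply E_sym).
  assert (Two : forall v u w i j, i <> j -> pair i u in_ c -> pair j w in_ c ->
    adj G v u -> adj G v w ->
    exists l, NoDup l /\ length l = d /\ forall z, List.In z l ->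
      (exists i, i < n /\ pair i z in_ c) /\ edge v z).
  { intros v u w i j Hij Hu Hw A A'; exists [u; w]; split; [|split; auto].
    - constructor; [|constructor; simpl; auto using NoDup_nil].
      intros [->|[]]; apply Hij; eauto.
    - assert (B : forall i z, pair i z in_ c -> i < n).
      { intros i0 z Hz; apply F1 in Hz as (i1 & z1 & H & _ & E).
        now apply pair_injective in E as (-> & _). }
      intros z [<-|[<-|[]]]; split; eauto; now apply HG. }
  apply (no_full_subgraph (fun v => exists i, i < n /\ pair i v in_ c) x).
  - exists 0; split; auto; rewrite Em; apply zero_lt, succ_nonzero.
  - intros v (i & Hi & Hv).
    assert (Next : i = m \/ exists w, pair (i + 1) w in_ c /\ adj G v w).
    { rewrite Em in Hi; apply lt_succ_le in Hi as [Hi|Hi]; auto; right.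
      assert (Hi' : i + 1 < n)
        by (rewrite Em; apply lt_succ_le, succ_le, Hi).
      destruct (F2 (i + 1) Hi') as (w & Hw & _); exists w; split; auto.
      now apply (Hadj i). }
    assert (Prev : i = 0 \/ exists j w, i = j + 1 /\ pair j w in_ c /\ adj G v w).
    { destruct (zero_or_succ i) as [->|(j & ->)]; auto; right.
      destruct (F2 j) as (w & Hw & _).
      { eapply lt_trans; [apply lt_succ_diag|exact Hi]. }
      exists j, w; repeat split; auto; apply adj_sym; now apply (Hadj j). }
    assert (Fun : forall u, pair i u in_ c -> u = v).
    { intros u Hu; destruct (F2 i Hi) as (z & _ & Hz).
      now rewrite <- (Hz u Hu), <- (Hz v Hv). }
    destruct Next as [Ei|(w & Hw & A)], Prev as [Ei'|(j & w' & Ej & Hw' & A')].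
    + exfalso; apply (succ_nonzero k); congruence.
    + assert (y = v) as <- by (apply Fun; now rewrite Ei).
      apply (Two y w' x j 0); auto.
      intros ->; apply Hk, succ_injective; congruence.
    + assert (x = v) as <- by (apply Fun; now rewrite Ei').
      apply (Two x w y (i + 1) m); auto.
      rewrite Ei', Em'; intros E; apply succ_injective in E; auto.
    + apply (Two v w w' (i + 1) j); auto.
      intros E; apply (lt_irrefl j); rewrite <- E at 2.
      apply lt_trans with i; [rewrite Ej|]; apply lt_succ_diag.
Qed.

Lemma gadget_max_degree (G : graph M) (b : bool) (x y : num M) :
  (forall u, u in_ V G) -> (forall u v, adj G u v <-> edge u v) ->
  pair x y in_ S b -> max_degree G (numeral d).
Proof.
  intros HV HG H; split.
  - intros u _; destruct (neighbours_exist u) as (l & (Nl & Hl) & Ll & _).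
    exists (numeral (length l)); split.
    + apply has_card_list; auto; intros v; now rewrite HG.
    + apply Nat.le_lteq in Ll as [Ll| ->]; auto using numeral_lt.
  - exists (vertex x (pair x y) 3); split; auto.
    destruct (gadget_vertex_neighbours b x y 3) as (N & Hl); auto; [lia|].
    pose proof (has_card_list (adj G (vertex x (pair x y) 3)) _ N) as C.
    rewrite length_map, gadget_degree_clique in C; auto.
    apply C; intros v; now rewrite HG.
Qed.

Lemma gadget_coloring (b : bool) (k : nat -> nat) :
  (forall t, (t < d + 2)%nat -> (k t < d)%nat) ->
  (forall t u, (t < d + 2)%nat -> (u < d + 2)%nat ->
     gadget b t u = true -> k t <> k u) ->
  k 0%nat = k 1%nat <-> b = false.
Proof.
  intros Hk Hadj.
  assert (E : k 0%nat = k (hub b)).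
  { apply NNPP; intros N.
    set (l := 0%nat :: hub b :: seq 3 (d - 1)).
    assert (Hl : forall t, List.In t l -> (t < d + 2)%nat).
    { intros t [<-|[<-|Ht]]; [lia|destruct b; simpl; lia|].
      apply in_seq in Ht; lia. }
    assert (Nl : NoDup l).
    { constructor; [|constructor; [|apply seq_NoDup]].
      - intros [Ht|Ht]; [now destruct b|apply in_seq in Ht; lia].
      - intros Ht; apply in_seq in Ht; destruct b; simpl in Ht; lia. }
    assert (Nk : NoDup (map k l)).
    { apply NoDup_map_NoDup_ForallPairs; auto.
      intros t u Ht Hu Etu; apply NNPP; intros Ntu.
      destruct (gadget b t u) eqn:G; [now apply (Hadj t u); auto|].
      destruct (gadget_adjacent d b t u) as [(-> & ->)|(-> & ->)]; auto. }
    assert (I : incl (map k l) (seq 0 d)).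
    { intros i Hi; apply in_map_iff in Hi as (t & <- & Ht).
      apply in_seq; specialize (Hk t (Hl t Ht)); lia. }
    pose proof (NoDup_incl_length Nk I) as L.
    rewrite length_map, length_seq in L; simpl in L.
    rewrite length_seq in L; lia. }
  rewrite E; destruct b; simpl; split; try congruence.
  intros E'; exfalso; apply (Hadj 2%nat 1%nat); auto; lia.
Qed.

Lemma separation_of_gadgets :
  BT d M -> exists X : sets M, forall x y,
    (pair x y in_ S true -> x in_ X) /\ (pair x y in_ S false -> ~ x in_ X).
Proof.
  intros HBT.
  destruct (classic (exists b x y, pair x y in_ S b)) as [(b0 & x0 & y0 & H0)|N].
  2: { destruct (sets_nonempty M HM) as (X & _); exists X; intros x y.
       split; intros H; exfalso; eauto. }
  destruct edge_graph as (G & HV & HG).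
  destruct (HBT G) as (c & (C1 & C2) & Hc).
  - now apply (gadget_max_degree G b0 x0 y0).
  - destruct (Nat.eqb_spec d 2).
    + intros (n & v & Hn & Hv); revert Hv; now apply no_odd_cycle.
    + intros (K & HK); revert HK; now apply no_clique.
  - destruct (comprehension_def (fun x => exists i, List.In i (seq 0 d) /\
      (pair (vertex x x 0) (numeral i) in_ c /\
       ~ pair (vertex x x 1) (numeral i) in_ c))) as (X & HX); [def|].
    assert (K : forall b x y, pair x y in_ S b -> (x in_ X <-> b = true)).
    { intros b x y H.
      destruct (finite_choice 0%nat (fun t i => (i < d)%nat /\
        pair (vertex x (pair x y) t) (numeral i) in_ c) (d + 2)) as (k & Hk).
      { intros t Ht; destruct (C2 (vertex x (pair x y) t)) as (j & Hj & _); auto.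
        destruct (C1 _ Hj) as (v & j' & _ & L & E).
        apply pair_injective in E as (_ & <-).
        apply below_numeral in L as (i & Hi & ->); eauto. }
      assert (Fun : forall t i, (t < d + 2)%nat ->
        pair (vertex x (pair x y) t) (numeral i) in_ c -> k t = i).
      { intros t i Ht Hi; destruct (C2 (vertex x (pair x y) t)) as (j & _ & Hj);
          auto.
        apply (numeral_injective (M := M)).
        now rewrite <- (Hj _ Hi), <- (Hj _ (proj2 (Hk t Ht))). }
      assert (E : k 0%nat = k 1%nat <-> b = false).
      { apply gadget_coloring; [intros t Ht; now apply Hk|].
        intros t u Ht Hu Htu E.
        apply (Hc (vertex x (pair x y) t) (vertex x (pair x y) u)
          (numeral (k t))); [|now apply Hk|rewrite E; now apply Hk].
        apply HG; exists b, t, u, x, y; auto 10. }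
      rewrite HX, <- Bool.not_false_iff_true, <- E; split.
      - intros (i & _ & Hi & Hi') E'; apply Hi'.
        rewrite <- (Fun 0%nat i); [|lia|exact Hi].
        rewrite E'; apply (Hk 1%nat); lia.
      - intros NE; exists (k 0%nat); split; [|split].
        + destruct (Hk 0%nat); [lia|apply in_seq; lia].
        + apply (Hk 0%nat); lia.
        + intros H1; apply NE; symmetry; apply Fun; [lia|exact H1]. }
    exists X; intros x y; split; intros H; apply K in H; [now apply H|].
    intros C; now apply H in C.
Qed.

End GadgetGraph.

Lemma separation_of_BT {M : L2_structure} {HM : RCA0 M} (d : nat) :
  (2 <= d)%nat -> BT d M -> separation M.
Proof.
  intros hd HBT A B HA HB HAB.
  apply (separation_of_gadgets d hd (fun b : bool => if b then A else B)); auto.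
  intros [|]; eauto.
Qed.

Local Close Scope l2_scope.

Theorem theorem3p6 (d : nat) (hd : 2 <= d) : implies_over RCA0 (BT d) WKL0.
Proof.
  intros M HM HBT; split; auto.
  eapply WKL_of_separation, separation_of_BT; eauto.
Qed.
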